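(* Let $n \in \mathbb{N}$ be fixed and let $a, y_j \in \mathbb{R}^+$ $(j=1,\ldots,n)$. Let $b, c, p_j, \lambda, \mu \in \mathbb{C}$ $(j=1,\ldots,n)$, put $\mathbf{p} := \sum_{j=1}^{n} p_j$, and assume $0<\Re(\mu)<\Re(\lambda+\mathbf{p})+n$. Then $$\int_{0}^{\infty} x^{\mu-1}\left(x+a+\sqrt{x^{2}+2ax}\right)^{-\lambda}\prod_{j=1}^{n}\mathcal{W}_{p_j,b,c}\left(\frac{y_j}{x+a+\sqrt{x^{2}+2ax}}\right)dx = \mathcal{A}\cdot F,$$ where $$\mathcal{A} = \frac{(\lambda+\mathbf{p}+n)\,2^{1-\mu-\mathbf{p}-n}\,a^{\mu-\lambda-\mathbf{p}-n}\,\Gamma(2\mu)\,\Gamma(\lambda+\mathbf{p}+n-\mu)\,\prod_{j=1}^{n} y_j^{p_j+1}}{\left\{\Gamma\left(\frac{3}{2}\right)\right\}^{n}\,\Gamma(1+\lambda+\mathbf{p}+n+\mu)\,\prod_{j=1}^{n}\Gamma\left(p_j+\frac{b+2}{2}\right)}$$ and $F$ is the generalized Lauricella function $$F = F^{2:1;\cdots;1}_{2:2;\cdots;2}\left(\begin{array}{l} [1+\lambda+\mathbf{p}+n:2,\ldots,2],\ [\lambda+\mathbf{p}+n-\mu:2,\ldots,2] : [1:1];\cdots;[1:1]; \\ {}[\lambda+\mathbf{p}+n:2,\ldots,2],\ [1+\lambda+\mathbf{p}+n+\mu:2,\ldots,2] : \left[\frac{3}{2}:1\right],\left[p_1+\frac{b+2}{2}:1\right];\cdots;\left[\frac{3}{2}:1\right],\left[p_n+\frac{b+2}{2}:1\right];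 \end{array} -\frac{c\,y_1^2}{4a^2},\ldots,-\frac{c\,y_n^2}{4a^2}\right),$$ in which $1;\cdots;1$ and $2;\cdots;2$ are arrays of length $n$.
   Context: $\mathbb{R}^+$ is the set of positive real numbers, $\mathbb{N}$ the set of positive integers, $\Gamma$ the gamma function. Complex powers of positive reals are $t^{s}=e^{s\log t}$ with real $\log t$. The generalized Struve function is, for $p,b,c\in\mathbb{C}$, $$\mathcal{W}_{p,b,c}(z)=\sum_{k=0}^{\infty}\frac{(-c)^{k}\left(\frac{z}{2}\right)^{2k+p+1}}{\Gamma\left(k+\frac{3}{2}\right)\Gamma\left(k+p+\frac{b+2}{2}\right)}$$ (with $1/\Gamma$ equal to $0$ at the poles of $\Gamma$). The Pochhammer symbol is $(\alpha)_\nu=\Gamma(\alpha+\nu)/\Gamma(\alpha)$; in particular $(\alpha)_0=1$ and $(\alpha)_m=\alpha(\alpha+1)\cdots(\alpha+m-1)$ for $m\in\mathbb{N}$. The generalized Lauricella function (Srivastava–Daoust) $$F_{C:D^{(1)};\cdots;D^{(n)}}^{A:B^{(1)};\cdots;B^{(n)}}\left(\begin{array}{l}[(a):\theta^{(1)},\ldots,\theta^{(n)}]:[(b)^{(1)}:\phi^{(1)}];\ldots;[(b)^{(n)}:\phi^{(n)}];\\ {}[(c):\psi^{(1)},\ldots,\psi^{(n)}]:[(d)^{(1)}:\delta^{(1)}];\ldots;[(d)^{(n)}:\delta^{(n)}];\end{array} z_1,\ldots,z_n\right)$$ is defined as $\sum_{k_1,\ldots,k_n=0}^{\infty}\Omega(k_1,\ldots,k_n)\frac{z_1^{k_1}}{k_1!}\cdots\frac{z_n^{k_n}}{k_n!}$,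 where $$\Omega(k_1,\ldots,k_n)=\frac{\prod_{j=1}^{A}(a_j)_{k_1\theta_j^{(1)}+\cdots+k_n\theta_j^{(n)}}\ \prod_{m=1}^{n}\prod_{j=1}^{B^{(m)}}(b_j^{(m)})_{k_m\phi_j^{(m)}}}{\prod_{j=1}^{C}(c_j)_{k_1\psi_j^{(1)}+\cdots+k_n\psi_j^{(n)}}\ \prod_{m=1}^{n}\prod_{j=1}^{D^{(m)}}(d_j^{(m)})_{k_m\delta_j^{(m)}}}.$$ Here $(a)$ abbreviates the array $a_1,\ldots,a_A$, $(b)^{(m)}$ the array $b_1^{(m)},\ldots,b_{B^{(m)}}^{(m)}$, and similarly for $(c)$, $(d)^{(m)}$; the coefficients $\theta,\phi,\psi,\delta$ are positive reals. As usual for hypergeometric-type series, the right-hand side is understood for parameters for which it is defined, i.e. $p_j+\frac{b+2}{2}\notin\{0,-1,-2,\ldots\}$ for all $j$. *)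

(* Defs.v *)
From HB Require Import structures.
From mathcomp Require Import all_boot all_order all_algebra finmap.
From mathcomp Require Import all_classical all_reals all_analysis.
From mathcomp Require summability.
From mathcomp Require Import complex.

Set Implicit Arguments.
Unset Strict Implicit.
Unset Printing Implicit Defensive.
Import Order.TTheory GRing.Theory Num.Theory.
Import numFieldNormedType.Exports.
Local Open Scope classical_set_scope.
Local Open Scope ring_scope.
Local Open Scope complex_scope.

Section Complex.
Context {R : realType}.
Implicit Types (z s alpha : R[i]) (t nu : R) (D : set R) (f : R -> R[i]).

Definition cexp z : R[i] :=
  (expR (complex.Re z))%:C * (cos (complex.Im z) +i* sin (complex.Im z)).

(* t^s = e^(s log t), meaningful for 0 < t. *)
Definition cpow t s : R[i] := cexp (s * (ln t)%:C).

Definition cintegrable D f : Prop :=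
  (@lebesgue_measure R).-integrable D (fun x => (complex.Re (f x))%:E) /\
  (@lebesgue_measure R).-integrable D (fun x => (complex.Im (f x))%:E).

Definition cintegral D f : R[i] :=
  (\int[@lebesgue_measure R]_(x in D) complex.Re (f x)) +i*
  (\int[@lebesgue_measure R]_(x in D) complex.Im (f x)).

Definition euler_integral z : R[i] :=
  cintegral `]0, +oo[ (fun t => cpow t (z - 1) * (expR (- t))%:C).

(* Off the half-plane 0 < Re z, the functional equation
   Gamma (z + m) = z (z + 1) ... (z + m - 1) Gamma z is used with the least m
   such that 0 < Re (z + m).  At a pole z = 0, -1, ... the product vanishes, so
   that cgamma z = 0, and hence (cgamma z)^-1 = 0, the usual value of
   1 / Gamma. *)
Definition cgamma z : R[i] :=
  if 0 < complex.Re z then euler_integral z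
  else let m := (Num.truncn (- complex.Re z)).+1 in
       euler_integral (z + m%:R) / \prod_(i < m) (z + i%:R).

Definition gamma_pole z : Prop := exists m : nat, z = - m%:R.

Lemma cgamma_pole z : gamma_pole z -> cgamma z = 0.
Proof.
move=> [m ->]; rewrite /cgamma.
have -> : complex.Re (- (m%:R : R[i])) = - m%:R.
  by rewrite raddfN /= -(rmorph_nat (real_complex R)).
rewrite ltNge oppr_le0 ler0n /= opprK natrK.
by rewrite (bigD1 ord_max) //= addNr mul0r invr0 mulr0.
Qed.

(* At a pole alpha of Gamma, the quotient Gamma (alpha + nu) / Gamma alpha is
   read as its limit alpha (alpha + 1) ... (alpha + nu - 1) when nu is a natural
   number; it is 0 for the other nu >= 0. *)
Definition pochhammer alpha nu : R[i] :=
  if `[< gamma_pole alpha >] && (nu \is a Num.nat)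
  then \prod_(i < Num.truncn nu) (alpha + i%:R)
  else cgamma (alpha + nu%:C) / cgamma alpha.

(* Restricted to positive arguments, for which the powers are defined. *)
Definition struve (p b c : R[i]) (x : R) : R[i] :=
  limn (series (fun k : nat =>
    (- c) ^+ k * cpow (x / 2) (2 * k%:R + p + 1) /
    (cgamma (k%:R + 3 / 2) * cgamma (k%:R + p + (b + 2) / 2)) : R[i]^o)).

End Complex.

Section Lauricella.
Context {R : realType} {n : nat}.

(* An entry [a_j : theta_j^(1), ..., theta_j^(n)], and an entry
   [b_j^(m) : phi_j^(m)]; the lengths of the lists are the numbers A, C and
   B^(m), D^(m). *)
Definition joint_param : Type := (R[i] * ('I_n -> R))%type.
Definition single_param : Type := (R[i] * R)%type.

Definition joint_poch (s : seq joint_param) (k : {ffun 'I_n -> nat}) : R[i] :=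
  \prod_(q <- s) pochhammer q.1 (\sum_m (k m)%:R * q.2 m).

Definition single_poch (s : 'I_n -> seq single_param)
    (k : {ffun 'I_n -> nat}) : R[i] :=
  \prod_m \prod_(q <- s m) pochhammer q.1 ((k m)%:R * q.2).

Definition lauricella_term (a : seq joint_param) (b : 'I_n -> seq single_param)
    (c : seq joint_param) (d : 'I_n -> seq single_param)
    (z : 'I_n -> R[i]) (k : {ffun 'I_n -> nat}) : R[i]^o :=
  (joint_poch a k * single_poch b k) / (joint_poch c k * single_poch d k) *
  \prod_m (z m ^+ k m / (k m)`!%:R).

(* Sums over the multi-indices k in N^n are unconditional, i.e. limits of the
   sums over finite sets of multi-indices. *)
Definition lauricella_cvg a b c d z : Prop :=
  cvg (summability.partial_sum (lauricella_term a b c d z)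
         @ summability.totally).

Definition lauricella a b c d z : R[i] :=
  summability.sum (lauricella_term a b c d z).

End Lauricella.

(* Main.v *)
Require Import Defs.
From mathcomp Require Import all_boot all_order all_algebra finmap.
From mathcomp Require Import all_classical all_reals all_analysis.
From mathcomp Require Import complex measurable_realfun.
From mathcomp Require summability.
From mathcomp Require Import ring lra.
Set Implicit Arguments.
Unset Strict Implicit.
Unset Printing Implicit Defensive.
Import Order.TTheory GRing.Theory Num.Theory.
Import numFieldNormedType.Exports.
Local Open Scope classical_set_scope.
Local Open Scope ring_scope.
Local Open Scope complex_scope.

(** Put [X = x + a + sqrt (x^2 + 2 a x)] and [s = lambda + P + n], where [P] is
    the sum of the [p j].  Multiplying the [n] Struve series in [y j / X], the
    integrand becomes a multiple series over [k] in [N^n] whose terms are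
    constants times [x^(mu - 1) X^-(s + 2 |k|)].

    Since [a <= X], the [j]-th series is [X^-(p j + 1)] times a series dominated,
    uniformly in [x], by the summable [struve_weight], whose terms eventually
    decrease geometrically because the ratio of consecutive terms is of order
    [1 / k^2].  All partial sums over cubes of multi-indices are therefore
    dominated by a constant times [x^(Re mu - 1) X^-(Re s)], which is integrable
    for [0 < Re mu < Re s], and dominated convergence gives termwise integration
    ([struve_integral_cvg]).

    The single integrals ([single_power_integral]) come from the substitution
    [x = a r^2 / (2 (1 + r))].  It gives [X = a (1 + r)] and splits the integrand
    into two beta integrands [r^(2 mu - 1) (1 + r)^-(s + mu)] and
    [r^(2 mu - 1) (1 + r)^-(s + mu + 1)]; the recursion of the gamma function
    combines the two values into
    [2^(1 - mu) a^(mu - s) s Gamma (2 mu) Gamma (s - mu) / Gamma (1 + s + mu)].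

    Multiplied by their coefficients, these values at [s + 2 |k|] are the terms
    of the Lauricella series times the prefactor: Pochhammer symbols are
    quotients of gamma values, and the factor [s + 2 |k|] is [s] times the
    quotient of the symbols of [1 + s] and [s].  The prefactor does not vanish,
    so the Lauricella series inherits absolute convergence, and its
    unconditional sum is the limit along the cubes ([unconditional_sum_cvg]).

    The facts about the gamma function are proved from Euler's integral: the
    recursion by integration by parts ([euler_integralS]), the beta integral by
    exchanging the integrals of a double kernel ([beta_integral]), and the
    absence of zeros ([euler_integral_neq0]), needed to divide by gamma values,
    from an estimate for arguments of large real part, which the recursion
    carries to the whole half-plane. *)

(** * Integrals over the positive half-line *)

Section HalfLine.
Context {R : realType}.
Local Notation mu := (@lebesgue_measure R).
Local Notation D0 := (`]0%R, +oo[%classic : set R).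
Implicit Types (f g phi dphi : R -> R).

Definition continuous_pos f := forall x : R, 0 < x -> {for x, continuous f}.

Lemma continuous_pos_measurable f : continuous_pos f -> measurable_fun D0 f.
Proof.
move=> cf; apply: open_continuous_measurable_fun; first exact: interval_open.
by move=> x; rewrite inE/= in_itv/= andbT => /cf.
Qed.

Lemma continuous_pos_within f u v :
  0 < u -> continuous_pos f -> {within `[u, v], continuous f}.
Proof.
move=> u0 cf; apply: continuous_in_subspaceT => x.
rewrite inE/= in_itv/= => /andP[ux _]; apply: cf; exact: lt_le_trans u0 ux.
Qed.

Lemma eq_continuous_pos f g :
  (forall x : R, 0 < x -> f x = g x) -> continuous_pos f -> continuous_pos g.
Proof.
move=> fg cf x x0; rewrite /prop_for /continuous_at -fg//.
apply: cvg_trans (cf x x0); apply: near_eq_cvg.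
by near=> z; apply: fg; near: z; exact: lt_nbhsr.
Unshelve. all: by end_near. Qed.

(** For increasing [phi] these intervals are the images of the intervals
    [[1 / (N + 1), N + 1]], so that the two sides of a substitution are exhausted
    by corresponding compact intervals. *)
Let I phi (N : nat) : set R := `[phi (N.+1%:R)^-1, phi N.+1%:R]%classic.

Lemma half_line_bigcup (phi : R -> R) :
  (forall x y : R, 0 < x -> x <= y -> phi x <= phi y) ->
  (forall x : R, 0 < x -> 0 < phi x) ->
  (forall y : R, 0 < y -> exists2 x : R, 0 < x & phi x = y) ->
  \bigcup_N I phi N = D0.
Proof.
move=> phi_le phi_gt0 phi_surj; apply/seteqP; split=> [y|y] /=.
  move=> [N _]; rewrite /I/= !in_itv/= andbT => /andP[+ _].
  by apply: lt_le_trans; apply: phi_gt0; rewrite invr_gt0 ltr0n.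
rewrite in_itv/= andbT => y0; have [x x0 <-] := phi_surj _ y0.
pose N := maxn (Num.truncn x) (Num.truncn x^-1).
have xN : x <= N.+1%:R.
  by rewrite (le_trans (ltW (truncnS_gt x)))// ler_nat ltnS leq_maxl.
have Nx : N.+1%:R^-1 <= x.
  rewrite -[leRHS]invrK lef_pV2 ?posrE ?invr_gt0//.
  by rewrite (le_trans (ltW (truncnS_gt x^-1)))// ler_nat ltnS leq_maxr.
by exists N => //; rewrite /I/= in_itv/= !phi_le//= invr_gt0 ltr0n.
Qed.

Lemma cvg_exhaust phi f :
  (forall x y : R, 0 < x -> x <= y -> phi x <= phi y) ->
  (forall x : R, 0 < x -> 0 < phi x) ->
  (forall y : R, 0 < y -> exists2 x : R, 0 < x & phi x = y) ->
  measurable_fun D0 f -> (forall x : R, 0 < x -> 0 <= f x) ->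
  (\int[mu]_(x in I phi N) (f x)%:E)%E @[N --> \oo]
    --> (\int[mu]_(x in D0) (f x)%:E)%E.
Proof.
move=> phi_le phi_gt0 phi_surj mf f0.
rewrite -[in X in _ --> X](half_line_bigcup phi_le phi_gt0 phi_surj).
have ID N : I phi N `<=` D0.
  move=> x; rewrite /I/= !in_itv/= andbT => /andP[+ _]; apply: lt_le_trans.
  by apply: phi_gt0; rewrite invr_gt0 ltr0n.
have := @ge0_nondecreasing_set_cvg_integral _ (measurableTypeR R) R
  (I phi) (EFin \o f) mu.
apply.
- apply/nondecreasing_seqP => N; rewrite subsetEset => x; rewrite /I/=.
  rewrite !in_itv/= => /andP[ax xb]; apply/andP; split.
    apply: le_trans ax; apply: phi_le; first by rewrite invr_gt0 ltr0n.
    by rewrite lef_pV2 ?posrE ?ltr0n// ler_nat.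
  by apply: le_trans xb _; apply: phi_le; rewrite ?ltr0n// ler_nat.
- by move=> N; exact: measurable_itv.
- move=> N; apply/measurable_EFinP; apply: measurable_funS (mf) => //.
- by move=> N x /ID /=; rewrite in_itv/= andbT lee_fin => /f0.
Qed.

(** On each compact interval this is the substitution rule for continuous
    functions; both sides then increase to the integrals over the half-line. *)
Lemma ge0_change_of_variables phi dphi f :
  (forall x : R, 0 < x -> is_derive x 1 phi (dphi x)) ->
  continuous_pos dphi -> (forall x : R, 0 < x -> 0 < dphi x) ->
  (forall x : R, 0 < x -> 0 < phi x) ->
  (forall y : R, 0 < y -> exists2 x : R, 0 < x & phi x = y) ->
  continuous_pos f -> (forall x : R, 0 < x -> 0 <= f x) ->
  (\int[mu]_(x in D0) (f x)%:E =
   \int[mu]_(x in D0) (f (phi x) * dphi x)%:E)%E.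
Proof.
move=> dphiE cdphi dphi0 phi0 phi_surj cf f0.
have cphi : continuous_pos phi.
  move=> x x0; apply: differentiable_continuous; apply/derivable1_diffP.
  by case: (dphiE x x0).
have phi_lt x y : 0 < x -> x < y -> phi x < phi y.
  move=> x0 xy.
  have [|z|z zxy e] := @MVT _ phi dphi x y xy.
  - move=> z; rewrite in_itv/= => /andP[xz _]; apply: dphiE; exact: lt_trans xz.
  - exact: continuous_pos_within.
  - rewrite -subr_gt0 e mulr_gt0 ?subr_gt0//; apply: dphi0.
    by move: zxy; rewrite in_itv/= => /andP[+ _]; exact: lt_trans.
have phi_le x y : 0 < x -> x <= y -> phi x <= phi y.
  by move=> x0; rewrite le_eqVlt => /predU1P[->//|xy]; exact/ltW/phi_lt.
have L := cvg_exhaust phi_le phi0 phi_surj (continuous_pos_measurable cf) f0.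
have cfphi : continuous_pos (fun x => f (phi x) * dphi x).
  move=> x x0; apply: cvgM; last exact: cdphi.
  apply: continuous_comp; [exact: cphi|exact/cf/phi0].
have L' : (\int[mu]_(x in I id N) (f (phi x) * dphi x)%:E)%E
    @[N --> \oo] --> (\int[mu]_(x in D0) (f (phi x) * dphi x)%:E)%E.
  apply: (@cvg_exhaust id) => //.
  - by move=> y y0; exists y.
  - exact: continuous_pos_measurable.
  - by move=> x x0; rewrite mulr_ge0 ?f0 ?phi0 ?ltW ?dphi0.
move/cvg_lim : L => <-//; move/cvg_lim : L' => <-//.
congr (limn _); apply/funext => N.
have N0 : 0 < N.+1%:R^-1 :> R by rewrite invr_gt0 ltr0n.
have phi'E x : 0 < x -> phi^`()%classic x = dphi x.
  by move=> x0; rewrite derive1E; have [_ ->] := dphiE x x0.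
have cphi' : continuous_pos (phi^`()%classic).
  by apply: eq_continuous_pos cdphi => x x0; rewrite phi'E.
rewrite /I (@integration_by_substitution_increasing _ phi f).
- apply: eq_integral => x; rewrite inE/= in_itv/= => /andP[ux _].
  congr (_%:E); congr (_ * _); apply/phi'E; exact: lt_le_trans ux.
- by rewrite (le_trans (y := 1))// ?invf_le1// ler1n.
- move=> x y; rewrite in_itv/= => /andP[ux _] _; apply: phi_lt.
  exact: lt_le_trans ux.
- move=> x; rewrite in_itv/= => /andP[ux _]; apply: cphi'; exact: lt_trans ux.
- apply/cvg_ex; exists (phi^`()%classic (N.+1%:R)^-1).
  exact: cvg_at_right_filter (cphi' _ N0).
- apply/cvg_ex; exists (phi^`()%classic N.+1%:R).
  exact: cvg_at_left_filter (cphi' _ (ltr0Sn _ N)).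
- split.
  + move=> x; rewrite in_itv/= => /andP[ux _].
    by have [] := dphiE x (lt_trans N0 ux).
  + exact: cvg_at_right_filter (cphi _ N0).
  + exact: cvg_at_left_filter (cphi _ (ltr0Sn _ N)).
- by apply: continuous_pos_within => //; exact: phi0.
Qed.

Lemma funepos_max f : (fun x => (f x)%:E)^\+%E = (fun x => (Num.max (f x) 0)%:E).
Proof. by apply/funext => x; rewrite funeposE EFin_max. Qed.

Lemma funeneg_max f : (fun x => (f x)%:E)^\-%E = (fun x => (Num.max (- f x) 0)%:E).
Proof. by apply/funext => x; rewrite funenegE EFin_max EFinN. Qed.

Lemma continuous_pos_max0 f :
  continuous_pos f -> continuous_pos (fun x => Num.max (f x) 0).
Proof.
move=> cf x x0; apply: (@continuous_max _ _ f (cst 0) x); [exact: cf|].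
exact: cst_continuous.
Qed.

Lemma change_of_variables phi dphi f :
  (forall x : R, 0 < x -> is_derive x 1 phi (dphi x)) ->
  continuous_pos dphi -> (forall x : R, 0 < x -> 0 < dphi x) ->
  (forall x : R, 0 < x -> 0 < phi x) ->
  (forall y : R, 0 < y -> exists2 x : R, 0 < x & phi x = y) ->
  continuous_pos f ->
  (\int[mu]_(x in D0) (f x)%:E =
   \int[mu]_(x in D0) (f (phi x) * dphi x)%:E)%E.
Proof.
move=> dphiE cdphi dphi0 phi0 phi_surj cf.
rewrite integralE [RHS]integralE !funepos_max !funeneg_max.
congr (_ - _)%E.
- rewrite (ge0_change_of_variables dphiE)//; last 2 first.
  + exact: continuous_pos_max0.
  + by move=> x _; rewrite le_max lexx orbT.
  apply: eq_integral => x; rewrite inE/= in_itv/= andbT => x0.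
  by rewrite maxr_pMl ?mul0r// ltW// dphi0.
- rewrite (ge0_change_of_variables
    (f := fun x => Num.max (- f x) 0) dphiE)//; last 2 first.
  + by apply: continuous_pos_max0 => x x0; apply: cvgN; exact: cf.
  + by move=> x _; rewrite le_max lexx orbT.
  apply: eq_integral => x; rewrite inE/= in_itv/= andbT => x0.
  by rewrite maxr_pMl ?mul0r ?mulNr// ltW// dphi0.
Qed.

Lemma integrable_change_of_variables phi dphi f :
  (forall x : R, 0 < x -> is_derive x 1 phi (dphi x)) ->
  continuous_pos dphi -> (forall x : R, 0 < x -> 0 < dphi x) ->
  (forall x : R, 0 < x -> 0 < phi x) ->
  (forall y : R, 0 < y -> exists2 x : R, 0 < x & phi x = y) ->
  continuous_pos f ->
  mu.-integrable D0 (EFin \o f) <->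
  mu.-integrable D0 (EFin \o (fun x => f (phi x) * dphi x)).
Proof.
move=> dphiE cdphi dphi0 phi0 phi_surj cf.
have cphi : continuous_pos phi.
  move=> x x0; apply: differentiable_continuous; apply/derivable1_diffP.
  by case: (dphiE x x0).
have cfphi : continuous_pos (fun x => f (phi x) * dphi x).
  move=> x x0; apply: cvgM; last exact: cdphi.
  apply: continuous_comp; [exact: cphi|exact/cf/phi0].
have mf := continuous_pos_measurable cf.
have mfphi := continuous_pos_measurable cfphi.
have e : (\int[mu]_(x in D0) `|(f x)%:E| =
    \int[mu]_(x in D0) `|(f (phi x) * dphi x)%:E|)%E.
  rewrite (@ge0_change_of_variables phi dphi (fun x => `|f x|))//.
    apply: eq_integral => x; rewrite inE/= in_itv/= andbT => x0.
    by rewrite normrM (gtr0_norm (dphi0 _ x0)).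
  by move=> x x0; apply: cvg_norm; exact: cf.
split=> /integrableP[_ h]; apply/integrableP; split.
- exact/measurable_EFinP.
- by rewrite /= -e.
- exact/measurable_EFinP.
- by rewrite /= e.
Qed.

End HalfLine.

(** * Complex numbers and powers of positive reals *)

Local Notation normc := ComplexField.Normc.normc.

Section ComplexPowers.
Context {R : realType}.
Implicit Types (z w s : R[i]) (t u x : R).
Local Notation Re := (@complex.Re R).
Local Notation Im := (@complex.Im R).

Lemma complex_eqP z w : Re z = Re w -> Im z = Im w -> z = w.
Proof. by case: z => a b; case: w => c d /= -> ->. Qed.
Lemma ReM z w : Re (z * w) = Re z * Re w - Im z * Im w.
Proof. by case: z => a b; case: w. Qed.
Lemma ImM z w : Im (z * w) = Re z * Im w + Im z * Re w.
Proof. by case: z => a b; case: w. Qed.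
Lemma ReD z w : Re (z + w) = Re z + Re w.
Proof. by case: z => a b; case: w. Qed.
Lemma ImD z w : Im (z + w) = Im z + Im w.
Proof. by case: z => a b; case: w. Qed.
Lemma ReN z : Re (- z) = - Re z. Proof. by case: z. Qed.
Lemma ImN z : Im (- z) = - Im z. Proof. by case: z. Qed.
Lemma ReB z w : Re (z - w) = Re z - Re w. Proof. by rewrite ReD ReN. Qed.
Lemma natC (n : nat) : (n%:R : R[i]) = (n%:R : R)%:C.
Proof. by rewrite (rmorph_nat (real_complex R)). Qed.
Lemma Re_nat (n : nat) : Re n%:R = n%:R. Proof. by rewrite natC. Qed.
Lemma Im_nat (n : nat) : Im n%:R = 0. Proof. by rewrite natC. Qed.
Lemma Re1 : Re 1 = 1. Proof. by []. Qed.
Lemma ReZ x z : Re (x%:C * z) = x * Re z.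
Proof. by rewrite ReM/= mul0r subr0. Qed.
Lemma ImZ x z : Im (x%:C * z) = x * Im z.
Proof. by rewrite ImM/= mul0r addr0. Qed.
Lemma ReZr x z : Re (z * x%:C) = Re z * x.
Proof. by rewrite mulrC ReZ mulrC. Qed.
Lemma ImZr x z : Im (z * x%:C) = Im z * x.
Proof. by rewrite mulrC ImZ mulrC. Qed.
Lemma Re_sum (I : Type) (r : seq I) (P : pred I) (F : I -> R[i]) :
  Re (\sum_(i <- r | P i) F i) = \sum_(i <- r | P i) Re (F i).
Proof. by elim/big_rec2: _ => // i x z _ <-; rewrite ReD. Qed.
Lemma Im_sum (I : Type) (r : seq I) (P : pred I) (F : I -> R[i]) :
  Im (\sum_(i <- r | P i) F i) = \sum_(i <- r | P i) Im (F i).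
Proof. by elim/big_rec2: _ => // i x z _ <-; rewrite ImD. Qed.

Lemma normcE z : normc z = Num.sqrt (Re z ^+ 2 + Im z ^+ 2).
Proof. by case: z. Qed.
Lemma normc_norm z : `|z| = (normc z)%:C.
Proof. by rewrite normc_def normcE. Qed.
Lemma normc_ge0 z : 0 <= normc z.
Proof. by rewrite normcE sqrtr_ge0. Qed.
Lemma normc_eq0 z : (normc z == 0) = (z == 0).
Proof.
apply/eqP/eqP => [/ComplexField.Normc.eq0_normc//|->].
exact: ComplexField.Normc.normc0.
Qed.
Lemma normc_real x : 0 <= x -> normc x%:C = x.
Proof. by move=> x0; rewrite normcE/= expr0n/= addr0 sqrtr_sqr ger0_norm. Qed.
Lemma Re_le_normc z : `|Re z| <= normc z.
Proof.
by rewrite normcE -sqrtr_sqr ler_wsqrtr// lerDl sqr_ge0.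
Qed.
Lemma Im_le_normc z : `|Im z| <= normc z.
Proof.
by rewrite normcE -sqrtr_sqr ler_wsqrtr// lerDr sqr_ge0.
Qed.
Lemma normc_le z : normc z <= `|Re z| + `|Im z|.
Proof.
rewrite normcE -(@ler_pXn2r _ 2)// ?nnegrE ?sqrtr_ge0 ?addr_ge0//.
rewrite sqr_sqrtr ?addr_ge0 ?sqr_ge0// -(real_normK (num_real (Re z))).
rewrite -(real_normK (num_real (Im z))).
have := normr_ge0 (Re z); have := normr_ge0 (Im z); nra.
Qed.
Lemma normc_prod (I : Type) (r : seq I) (P : pred I) (F : I -> R[i]) :
  normc (\prod_(i <- r | P i) F i) = \prod_(i <- r | P i) normc (F i).
Proof.
elim/big_rec2: _ => [|i x z _ <-]; first exact: ComplexField.Normc.normc1.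
by rewrite ComplexField.Normc.normcM.
Qed.
Lemma normc_sum (I : Type) (r : seq I) (P : pred I) (F : I -> R[i]) :
  normc (\sum_(i <- r | P i) F i) <= \sum_(i <- r | P i) normc (F i).
Proof.
elim/big_ind2: _ => [|x1 x2 y1 y2 h1 h2|//].
  by rewrite ComplexField.Normc.normc0.
by rewrite (le_trans (le_normcD _ _))// lerD.
Qed.

Lemma cexpE z : cexp z = (expR (Re z) * cos (Im z)) +i* (expR (Re z) * sin (Im z)).
Proof. by apply: complex_eqP; rewrite /cexp (ReZ, ImZ). Qed.
Lemma cexpD z w : cexp (z + w) = cexp z * cexp w.
Proof.
apply: complex_eqP; rewrite (ReM, ImM) !cexpE/= ReD ImD expRD (cosD, sinD); ring.
Qed.
Lemma cexp_real x : cexp x%:C = (expR x)%:C.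
Proof. by rewrite cexpE/= cos0 sin0 mulr1 mulr0. Qed.
Lemma cexp0 : cexp (0 : R[i]) = 1.
Proof. by rewrite (cexp_real 0) expR0. Qed.
Lemma normc_cexp z : normc (cexp z) = expR (Re z).
Proof.
rewrite normcE cexpE/= !exprMn -mulrDr cos2Dsin2 mulr1 sqrtr_sqr ger0_norm//.
Qed.
Lemma cexp_neq0 z : cexp z != 0.
Proof. by rewrite -normc_eq0 normc_cexp gt_eqF// expR_gt0. Qed.
Lemma cexpN z : cexp (- z) = (cexp z)^-1.
Proof.
apply: (mulfI (cexp_neq0 z)); rewrite -cexpD subrr cexp0 mulfV//.
exact: cexp_neq0.
Qed.

Lemma normc_cpow t s : normc (cpow t s) = expR (Re s * ln t).
Proof. by rewrite /cpow normc_cexp mulrC ReZ mulrC. Qed.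
Lemma cpow_neq0 t s : cpow t s != 0. Proof. exact: cexp_neq0. Qed.
Lemma cpowD t s w : cpow t (s + w) = cpow t s * cpow t w.
Proof. by rewrite /cpow mulrDl cexpD. Qed.
Lemma cpowN t s : cpow t (- s) = (cpow t s)^-1.
Proof. by rewrite /cpow mulNr cexpN. Qed.
Lemma cpowB t s w : cpow t (s - w) = cpow t s / cpow t w.
Proof. by rewrite cpowD cpowN. Qed.
Lemma cpow0 t : cpow t 0 = 1. Proof. by rewrite /cpow mul0r cexp0. Qed.
Lemma cpow_real t x : cpow t x%:C = (expR (x * ln t))%:C.
Proof. by rewrite /cpow -rmorphM/= cexp_real. Qed.
Lemma cpow1 t : 0 < t -> cpow t 1 = t%:C.
Proof. by move=> t0; rewrite (cpow_real t 1) mul1r lnK. Qed.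
Lemma cpow_nat t (n : nat) : 0 < t -> cpow t n%:R = t%:C ^+ n.
Proof.
move=> t0; elim: n => [|n IH]; first by rewrite cpow0 expr0.
by rewrite -natr1 cpowD IH cpow1// exprSr.
Qed.
Lemma cpow_sum t (I : Type) (r : seq I) (P : pred I) (F : I -> R[i]) :
  cpow t (\sum_(i <- r | P i) F i) = \prod_(i <- r | P i) cpow t (F i).
Proof.
by elim/big_rec2: _ => [|i x z _ <-]; rewrite ?cpow0// cpowD.
Qed.
Lemma cpowM t u s : 0 < t -> 0 < u -> cpow (t * u) s = cpow t s * cpow u s.
Proof. by move=> t0 u0; rewrite /cpow lnM// rmorphD/= mulrDr cexpD. Qed.
Lemma cpowV t s : 0 < t -> cpow t^-1 s = cpow t (- s).
Proof. by move=> t0; rewrite /cpow lnV// rmorphN/= mulrN mulNr. Qed.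

End ComplexPowers.

(** * Complex integrals over the positive half-line *)

Section HalfLineFubini.
Context {R : realType}.
Local Notation mu := (@lebesgue_measure R).
Local Notation D0 := (`]0%R, +oo[%classic : set R).
Implicit Types K : R -> R -> R.

Let quadrant : set (R * R) := D0 `*` D0.

(** Extension by zero outside the quadrant reduces iterated integrals over the
    half-line to those over the whole line, on which the theorems for product
    measures apply. *)
Let iterated_restrict (K : R -> R -> \bar R) :
  (\int[mu]_(x in D0) \int[mu]_(y in D0) K x y =
   \int[mu]_x \int[mu]_y ((fun z : R * R => K z.1 z.2) \_ quadrant) (x, y))%E.
Proof.
rewrite integral_mkcond; apply: eq_integral => x _; rewrite patchE.
case: ifPn => xD.
  rewrite integral_mkcond; apply: eq_integral => y _.
  by rewrite !patchE /quadrant in_setX xD.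
rewrite integral0_eq// => y _; rewrite patchE in_setX.
by rewrite (negbTE xD).
Qed.

Let iterated_restrict_swap (K : R -> R -> \bar R) :
  (\int[mu]_(y in D0) \int[mu]_(x in D0) K x y =
   \int[mu]_y \int[mu]_x ((fun z : R * R => K z.1 z.2) \_ quadrant) (x, y))%E.
Proof.
rewrite (iterated_restrict (fun y x => K x y)).
apply: eq_integral => y _; apply: eq_integral => x _.
by rewrite !patchE /quadrant !in_setX andbC.
Qed.

Let measurable_restrict_quadrant (K : R -> R -> \bar R) :
  measurable_fun setT (fun z : R * R => K z.1 z.2) ->
  measurable_fun setT ((fun z : R * R => K z.1 z.2) \_ quadrant).
Proof.
move=> mK; apply/(measurable_restrictT _ _).1 => //.
  by apply: measurableX; exact: measurable_itv.
exact: measurable_funS mK.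
Qed.

Lemma half_line_tonelli K :
  measurable_fun setT (fun z : R * R => K z.1 z.2) ->
  (forall x y, 0 <= K x y) ->
  (\int[mu]_(x in D0) \int[mu]_(y in D0) (K x y)%:E =
   \int[mu]_(y in D0) \int[mu]_(x in D0) (K x y)%:E)%E.
Proof.
move=> mK K0; rewrite iterated_restrict iterated_restrict_swap.
apply: fubini_tonelli.
  apply: (measurable_restrict_quadrant (K := fun x y => (K x y)%:E)).
  exact: (measurable_EFinP _ _).2 mK.
by move=> z; rewrite patchE; case: ifP => // _; rewrite lee_fin.
Qed.

Lemma half_line_fubini K :
  measurable_fun setT (fun z : R * R => K z.1 z.2) ->
  (\int[mu]_(x in D0) \int[mu]_(y in D0) `|(K x y)%:E| < +oo)%E ->
  (\int[mu]_(x in D0) \int[mu]_(y in D0) (K x y)%:E =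
   \int[mu]_(y in D0) \int[mu]_(x in D0) (K x y)%:E)%E.
Proof.
move=> mK K0; rewrite iterated_restrict iterated_restrict_swap.
have mK' := measurable_restrict_quadrant
  (K := fun x y => (K x y)%:E) ((measurable_EFinP _ _).2 mK).
apply: Fubini; apply/integrable12ltyP => //.
move: K0; rewrite iterated_restrict; congr (_ < _)%E.
apply: eq_integral => x _; apply: eq_integral => y _.
by rewrite !patchE; case: ifP => //; rewrite abse0.
Qed.

End HalfLineFubini.

Section ComplexIntegral.
Context {R : realType}.
Local Notation mu := (@lebesgue_measure R).
Local Notation D0 := (`]0%R, +oo[%classic : set R).
Local Notation Re := (@complex.Re R).
Local Notation Im := (@complex.Im R).
Implicit Types (f g : R -> R[i]) (h : R -> R).

Let mD0 : measurable (D0 : set (measurableTypeR R)). Proof. exact: measurable_itv. Qed.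

Lemma half_lineP (x : R) : (x \in D0) = (0 < x).
Proof. by apply/idP/idP; rewrite inE/= in_itv/= andbT. Qed.

Lemma D0P (x : R) : D0 x -> 0 < x.
Proof. by rewrite /= in_itv/= andbT. Qed.

Definition ccontinuous f :=
  continuous_pos (fun x => Re (f x)) /\ continuous_pos (fun x => Im (f x)).

Lemma ccontinuous_cst (k : R[i]) : ccontinuous (fun=> k).
Proof. by split=> x x0; exact: cst_continuous. Qed.

Lemma ccontinuousM f g :
  ccontinuous f -> ccontinuous g -> ccontinuous (fun x => f x * g x).
Proof.
move=> [rf If] [rg ig]; split.
  apply: (@eq_continuous_pos _ (fun x => Re (f x) * Re (g x) - Im (f x) * Im (g x))).
    by move=> x _; rewrite ReM.
  by move=> x x0; apply: cvgB; apply: cvgM; [exact: rf|exact: rg|exact: If|exact: ig].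
apply: (@eq_continuous_pos _ (fun x => Re (f x) * Im (g x) + Im (f x) * Re (g x))).
  by move=> x _; rewrite ImM.
by move=> x x0; apply: cvgD; apply: cvgM; [exact: rf|exact: ig|exact: If|exact: rg].
Qed.

Lemma ccontinuousD f g :
  ccontinuous f -> ccontinuous g -> ccontinuous (fun x => f x + g x).
Proof.
move=> [rf If] [rg ig]; split.
  apply: (@eq_continuous_pos _ (fun x => Re (f x) + Re (g x))).
    by move=> x _; rewrite ReD.
  by move=> x x0; apply: cvgD; [exact: rf|exact: rg].
apply: (@eq_continuous_pos _ (fun x => Im (f x) + Im (g x))).
  by move=> x _; rewrite ImD.
by move=> x x0; apply: cvgD; [exact: If|exact: ig].
Qed.

Lemma ccontinuous_sum (I : Type) (r : seq I) (F : I -> R -> R[i]) :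
  (forall i, ccontinuous (F i)) -> ccontinuous (fun x => \sum_(i <- r) F i x).
Proof.
move=> cF; elim: r => [|i r IH].
  by under eq_fun do rewrite big_nil; exact: ccontinuous_cst.
under eq_fun do rewrite big_cons; exact: ccontinuousD.
Qed.

Lemma ccontinuous_real h : continuous_pos h -> ccontinuous (fun x => (h x)%:C).
Proof. by move=> ch; split=> //= x _; exact: cst_continuous. Qed.

Lemma eq_ccontinuous f g :
  (forall x : R, 0 < x -> f x = g x) -> ccontinuous f -> ccontinuous g.
Proof.
by move=> fg [rf If]; split; [apply: eq_continuous_pos rf|apply: eq_continuous_pos If];
  move=> x x0; rewrite fg.
Qed.

Lemma continuous_pos_expR h :
  continuous_pos h -> continuous_pos (fun x => expR (h x)).
Proof.
move=> ch x x0; apply: (@continuous_comp _ _ _ h expR); first exact: ch.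
exact: continuous_expR.
Qed.

Lemma ccontinuous_cexp f :
  ccontinuous f -> ccontinuous (fun x => cexp (f x)).
Proof.
move=> [rf If].
have rexp : continuous_pos (fun x => expR (Re (f x))) by exact: continuous_pos_expR.
split.
  apply: (@eq_continuous_pos _ (fun x => expR (Re (f x)) * cos (Im (f x)))).
    by move=> x _; rewrite cexpE.
  move=> x x0; apply: cvgM; first exact: rexp.
  apply: (@continuous_comp _ _ _ (fun x => Im (f x)) cos); first exact: If.
  exact: continuous_cos.
apply: (@eq_continuous_pos _ (fun x => expR (Re (f x)) * sin (Im (f x)))).
  by move=> x _; rewrite cexpE.
move=> x x0; apply: cvgM; first exact: rexp.
apply: (@continuous_comp _ _ _ (fun x => Im (f x)) sin); first exact: If.
exact: continuous_sin.
Qed.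

Lemma ccontinuous_cpow h s : continuous_pos h ->
  (forall x : R, 0 < x -> 0 < h x) -> ccontinuous (fun x => cpow (h x) s).
Proof.
move=> ch h0; apply: ccontinuous_cexp; apply: ccontinuousM.
  exact: ccontinuous_cst.
apply: ccontinuous_real => x x0.
apply: (@continuous_comp _ _ _ h (@ln R)); first exact: ch.
exact/continuous_ln/h0.
Qed.

Lemma ccontinuous_cpow_id s : ccontinuous (fun x => cpow x s).
Proof. by apply: (@ccontinuous_cpow id) => // x _; exact: cvg_id. Qed.

Lemma Re_cintegral f : Re (cintegral D0 f) = \int[mu]_(x in D0) Re (f x).
Proof. by []. Qed.

Lemma eq_cintegral f g : (forall x : R, 0 < x -> f x = g x) ->
  cintegral D0 f = cintegral D0 g.
Proof.
move=> fg; rewrite /cintegral; congr (_ +i* _);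
  by apply: eq_Rintegral => x; rewrite half_lineP => /fg ->.
Qed.

Lemma eq_cintegrable f g : (forall x : R, 0 < x -> f x = g x) ->
  cintegrable D0 f -> cintegrable D0 g.
Proof.
move=> fg [rf If]; split.
  by apply: eq_integrable rf => // x; rewrite half_lineP => /fg ->.
by apply: eq_integrable If => // x; rewrite half_lineP => /fg ->.
Qed.

Definition cmeasurable f :=
  measurable_fun D0 (fun x => Re (f x)) /\ measurable_fun D0 (fun x => Im (f x)).

Lemma ccontinuous_measurable f : ccontinuous f -> cmeasurable f.
Proof. by move=> [? ?]; split; exact: continuous_pos_measurable. Qed.

Lemma measurable_normc d (T : measurableType d) (D : set T) (h : T -> R[i]) :
  measurable_fun D (fun x => Re (h x)) -> measurable_fun D (fun x => Im (h x)) ->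
  measurable_fun D (fun x => normc (h x)).
Proof.
move=> mR mI; rewrite (_ : (fun x => normc (h x)) =
  (fun x => Num.sqrt (Re (h x) ^+ 2 + Im (h x) ^+ 2))); last first.
  by apply/funext => x; rewrite normcE.
apply: (measurableT_comp (continuous_measurable_fun (@sqrt_continuous R))).
by apply: measurable_funD; exact: measurable_funX.
Qed.

Lemma cintegrable_dominated f h : cmeasurable f ->
  (forall x : R, 0 < x -> normc (f x) <= h x) ->
  mu.-integrable D0 (EFin \o h) -> cintegrable D0 f.
Proof.
move=> [rf If] fh ih; split.
  apply: le_integrable ih => //; first exact/measurable_EFinP.
  move=> x /D0P x0 /=; rewrite lee_fin (le_trans (Re_le_normc _))//.
  by rewrite (le_trans (fh _ x0))// ler_norm.
apply: le_integrable ih => //; first exact/measurable_EFinP.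
move=> x /D0P x0 /=; rewrite lee_fin (le_trans (Im_le_normc _))//.
by rewrite (le_trans (fh _ x0))// ler_norm.
Qed.

(** The factor 2 comes from bounding the real and imaginary parts
    separately. *)
Lemma normc_cintegral f h : cmeasurable f ->
  (forall x : R, 0 < x -> normc (f x) <= h x) ->
  mu.-integrable D0 (EFin \o h) ->
  normc (cintegral D0 f) <= 2 * \int[mu]_(x in D0) h x.
Proof.
move=> mf fh ih; have [rf If] := cintegrable_dominated mf fh ih.
rewrite (le_trans (normc_le _))// mulr2n mulrDl !mul1r /=.
apply: lerD; apply: (le_trans (le_normr_Rintegral _ _)) => //;
  apply: le_Rintegral => //.
- exact: integrable_norm.
- by move=> x /D0P x0; rewrite (le_trans (Re_le_normc _))// fh.
- exact: integrable_norm.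
- by move=> x /D0P x0; rewrite (le_trans (Im_le_normc _))// fh.
Qed.

Lemma integrable_linear (k1 k2 : R) h1 h2 :
  mu.-integrable D0 (EFin \o h1) -> mu.-integrable D0 (EFin \o h2) ->
  mu.-integrable D0 (EFin \o (fun x => k1 * h1 x + k2 * h2 x)) /\
  \int[mu]_(x in D0) (k1 * h1 x + k2 * h2 x) =
  k1 * (\int[mu]_(x in D0) h1 x) + k2 * (\int[mu]_(x in D0) h2 x).
Proof.
move=> i1 i2; have j1 := integrableZl mD0 k1 i1.
have j2 := integrableZl mD0 k2 i2; split; first exact: (integrableD mD0 j1 j2).
by rewrite RintegralD// !RintegralZl.
Qed.

Lemma cintegral_linear (k : R[i]) f g :
  cintegrable D0 f -> cintegrable D0 g ->
  cintegrable D0 (fun x => k * f x + g x) /\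
  cintegral D0 (fun x => k * f x + g x) = k * cintegral D0 f + cintegral D0 g.
Proof.
move=> [rf If] [rg Ig].
have ReE x : Re (k * f x + g x) =
    1 * (Re k * Re (f x) + - Im k * Im (f x)) + 1 * Re (g x).
  by rewrite ReD ReM !mul1r mulNr.
have ImE x : Im (k * f x + g x) =
    1 * (Re k * Im (f x) + Im k * Re (f x)) + 1 * Im (g x).
  by rewrite ImD ImM !mul1r.
have [i1 e1] := integrable_linear (Re k) (- Im k) rf If.
have [i2 e2] := integrable_linear (Re k) (Im k) If rf.
have [i3 e3] := integrable_linear 1 1 i1 rg.
have [i4 e4] := integrable_linear 1 1 i2 Ig.
split.
  split.
    have -> : (fun x => (Re (k * f x + g x))%:E) =
      EFin \o (fun x => 1 * (Re k * Re (f x) + - Im k * Im (f x)) + 1 * Re (g x)).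
      by apply/funext => x /=; rewrite ReE.
    exact: i3.
  have -> : (fun x => (Im (k * f x + g x))%:E) =
    EFin \o (fun x => 1 * (Re k * Im (f x) + Im k * Re (f x)) + 1 * Im (g x)).
    by apply/funext => x /=; rewrite ImE.
  exact: i4.
apply: complex_eqP; rewrite (ReD, ImD) (ReM, ImM) /cintegral/=.
  have -> : (fun x => Re (k * f x + g x)) =
    (fun x => 1 * (Re k * Re (f x) + - Im k * Im (f x)) + 1 * Re (g x)).
    by apply/funext => x; rewrite ReE.
  by rewrite e3 e1 !mul1r mulNr.
have -> : (fun x => Im (k * f x + g x)) =
  (fun x => 1 * (Re k * Im (f x) + Im k * Re (f x)) + 1 * Im (g x)).
  by apply/funext => x; rewrite ImE.
by rewrite e4 e2 !mul1r.
Qed.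

Lemma cintegrableD f g : cintegrable D0 f -> cintegrable D0 g ->
  cintegrable D0 (fun x => f x + g x) /\
  cintegral D0 (fun x => f x + g x) = cintegral D0 f + cintegral D0 g.
Proof.
move=> cf cg; have := cintegral_linear 1 cf cg.
rewrite mul1r.
by have -> : (fun x => 1 * f x + g x) = (fun x => f x + g x)
  by apply/funext => x; rewrite mul1r.
Qed.

Lemma cintegral0 :
  cintegrable D0 (fun=> 0 : R[i]) /\ cintegral D0 (fun=> 0 : R[i]) = 0.
Proof.
split; first by split; exact: integrable0.
by apply: complex_eqP; rewrite /cintegral/= /Rintegral integral0.
Qed.

Lemma cintegralZ k f : cintegrable D0 f ->
  cintegrable D0 (fun x => k * f x) /\
  cintegral D0 (fun x => k * f x) = k * cintegral D0 f.
Proof.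
have [i0 e0] := cintegral0 => cf; have := cintegral_linear k cf i0.
rewrite e0 addr0.
by have -> : (fun x => k * f x + 0) = (fun x => k * f x)
  by apply/funext => x; rewrite addr0.
Qed.

Lemma cintegral_sum (I : Type) (r : seq I) (F : I -> R -> R[i]) :
  (forall i, cintegrable D0 (F i)) ->
  cintegrable D0 (fun x => \sum_(i <- r) F i x) /\
  cintegral D0 (fun x => \sum_(i <- r) F i x) = \sum_(i <- r) cintegral D0 (F i).
Proof.
move=> iF; elim: r => [|i r [IH1 IH2]].
  have -> : (fun x => \sum_(i <- [::]) F i x) = fun=> 0 :> R[i].
    by apply/funext => x; rewrite big_nil.
  by rewrite big_nil; exact: cintegral0.
have -> : (fun x => \sum_(j <- i :: r) F j x) =
    (fun x => F i x + \sum_(j <- r) F j x).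
  by apply/funext => x; rewrite big_cons.
by rewrite big_cons -IH2; exact: cintegrableD.
Qed.

Lemma cintegral_change phi dphi f :
  (forall x : R, 0 < x -> is_derive x 1 phi (dphi x)) ->
  continuous_pos dphi -> (forall x : R, 0 < x -> 0 < dphi x) ->
  (forall x : R, 0 < x -> 0 < phi x) ->
  (forall y : R, 0 < y -> exists2 x : R, 0 < x & phi x = y) ->
  ccontinuous f ->
  cintegral D0 f = cintegral D0 (fun x => (dphi x)%:C * f (phi x)).
Proof.
move=> h1 h2 h3 h4 h5 [rf If]; apply: complex_eqP; rewrite /= /Rintegral.
  rewrite (change_of_variables h1 h2 h3 h4 h5 rf).
  by congr (fine _); apply: eq_integral => x _; rewrite ReZ mulrC.
rewrite (change_of_variables h1 h2 h3 h4 h5 If).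
by congr (fine _); apply: eq_integral => x _; rewrite ImZ mulrC.
Qed.

Lemma cintegrable_change phi dphi f :
  (forall x : R, 0 < x -> is_derive x 1 phi (dphi x)) ->
  continuous_pos dphi -> (forall x : R, 0 < x -> 0 < dphi x) ->
  (forall x : R, 0 < x -> 0 < phi x) ->
  (forall y : R, 0 < y -> exists2 x : R, 0 < x & phi x = y) ->
  ccontinuous f ->
  cintegrable D0 f <-> cintegrable D0 (fun x => (dphi x)%:C * f (phi x)).
Proof.
move=> h1 h2 h3 h4 h5 [rf If].
have eR : (fun x => (Re ((dphi x)%:C * f (phi x)))%:E) =
    EFin \o (fun x => Re (f (phi x)) * dphi x).
  by apply/funext => x /=; rewrite ReZ mulrC.
have eI : (fun x => (Im ((dphi x)%:C * f (phi x)))%:E) =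
    EFin \o (fun x => Im (f (phi x)) * dphi x).
  by apply/funext => x /=; rewrite ImZ mulrC.
have iR := integrable_change_of_variables h1 h2 h3 h4 h5 rf.
have iI := integrable_change_of_variables h1 h2 h3 h4 h5 If.
rewrite /cintegrable eR eI; split=> -[i1 i2]; split.
- exact: iR.1 i1.
- exact: iI.1 i2.
- exact: iR.2 i1.
- exact: iI.2 i2.
Qed.

Lemma cintegral_dominated_cvg (F : nat -> R -> R[i]) f h :
  (forall N, cmeasurable (F N)) ->
  (forall x : R, 0 < x -> Re (F N x) @[N --> \oo] --> Re (f x)) ->
  (forall x : R, 0 < x -> Im (F N x) @[N --> \oo] --> Im (f x)) ->
  (forall N (x : R), 0 < x -> normc (F N x) <= h x) ->
  mu.-integrable D0 (EFin \o h) ->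
  [/\ cintegrable D0 f,
      Re (cintegral D0 (F N)) @[N --> \oo] --> Re (cintegral D0 f) &
      Im (cintegral D0 (F N)) @[N --> \oo] --> Im (cintegral D0 f)].
Proof.
move=> mF cR cI Fh ih.
have real_case (G : nat -> R -> R) (g : R -> R) :
    (forall N, measurable_fun D0 (G N)) ->
    (forall x : R, 0 < x -> G N x @[N --> \oo] --> g x) ->
    (forall N (x : R), 0 < x -> `|G N x| <= h x) ->
    mu.-integrable D0 (EFin \o g) /\
    \int[mu]_(x in D0) G N x @[N --> \oo] --> \int[mu]_(x in D0) g x.
  move=> mG cG Gh.
  have mg : measurable_fun D0 g.
    by apply: (measurable_fun_cvg mG) => x /D0P; exact: cG.
  have [] := @dominated_convergence _ (measurableTypeR R) R mu D0 mD0
    (fun N => EFin \o G N) (EFin \o g) (EFin \o h).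
  - by move=> N; apply/measurable_EFinP; exact: mG.
  - by apply/measurable_EFinP; exact: mg.
  - by apply: aeW => x /D0P x0; apply: cvg_EFin; [exact: nearW|exact: cG].
  - exact: ih.
  - by apply: aeW => x N /D0P x0 /=; rewrite lee_fin Gh.
  move=> ig _ cint; split=> //.
  apply: (@fine_cvg _ _ _ _ (fun N => \int[mu]_(x in D0) (G N x)%:E)%E).
  by rewrite fineK//; exact: integrable_fin_num ig.
have [iR cvR] := real_case _ _ (fun N => (mF N).1) cR
  (fun N x x0 => le_trans (Re_le_normc _) (Fh N x x0)).
have [iI cvI] := real_case _ _ (fun N => (mF N).2) cI
  (fun N x x0 => le_trans (Im_le_normc _) (Fh N x x0)).
by split.
Qed.

(** The integral of a nonnegative function is a supremum over the simple
    functions below it.  Reading monotonicity off this supremum allows inner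
    integrals to be compared as functions of the outer variable, without a proof
    that they are measurable. *)
Lemma le_ge0_integral (f g : R -> \bar R) :
  (forall x : R, 0 < x -> (0 <= f x)%E) ->
  (forall x : R, 0 < x -> (f x <= g x)%E) ->
  (\int[mu]_(x in D0) f x <= \int[mu]_(x in D0) g x)%E.
Proof.
move=> f0 fg; rewrite ge0_integralE; last by move=> x /D0P; exact: f0.
rewrite ge0_integralE; last first.
  by move=> x /D0P x0; rewrite (le_trans (f0 _ x0))// fg.
apply: le_ereal_sup => _ [k /= kf <-]; exists k => // x.
apply: (le_trans (kf x)); rewrite !patchE half_lineP.
by case: ifP => // /fg.
Qed.

(** The iterated integral of the majorant has to be finite only in the order in
    which it can be computed.  Integrability of the sections identifies the
    inner real integrals with the extended ones, to which Fubini's theorem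
    applies. *)
Lemma cintegral_fubini (K : R -> R -> R[i]) (A : R -> R -> R) :
  measurable_fun setT (fun z : R * R => Re (K z.1 z.2)) ->
  measurable_fun setT (fun z : R * R => Im (K z.1 z.2)) ->
  (forall x y : R, 0 < x -> 0 < y -> normc (K x y) <= A x y) ->
  (\int[mu]_(x in D0) \int[mu]_(y in D0) (A x y)%:E < +oo)%E ->
  (forall x : R, 0 < x -> cintegrable D0 (K x)) ->
  (forall y : R, 0 < y -> cintegrable D0 (K ^~ y)) ->
  cintegral D0 (fun x => cintegral D0 (K x)) =
  cintegral D0 (fun y => cintegral D0 (K ^~ y)).
Proof.
move=> mR mI KA Afin ix iy.
have real_case (k : R -> R -> R) :
    measurable_fun setT (fun z : R * R => k z.1 z.2) ->
    (forall x y : R, 0 < x -> 0 < y -> `|k x y| <= A x y) ->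
    (forall x : R, 0 < x -> mu.-integrable D0 (EFin \o (k x))) ->
    (forall y : R, 0 < y -> mu.-integrable D0 (EFin \o (k ^~ y))) ->
    \int[mu]_(x in D0) (\int[mu]_(y in D0) k x y) =
    \int[mu]_(y in D0) (\int[mu]_(x in D0) k x y).
  move=> mk kA ikx iky; rewrite /Rintegral; congr (fine _).
  transitivity (\int[mu]_(x in D0) \int[mu]_(y in D0) (k x y)%:E)%E.
    apply: eq_integral => x; rewrite half_lineP => x0.
    by rewrite fineK//; exact: integrable_fin_num (ikx x x0).
  rewrite half_line_fubini//.
    apply: eq_integral => y; rewrite half_lineP => y0.
    by rewrite fineK//; exact: integrable_fin_num (iky y y0).
  apply: le_lt_trans Afin; apply: le_ge0_integral => x x0.
    by apply: integral_ge0.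
  by apply: le_ge0_integral => y y0; rewrite ?lee_fin ?kA.
apply: complex_eqP; rewrite /cintegral/=; apply: real_case => //.
- by move=> x y x0 y0; rewrite (le_trans (Re_le_normc _))// KA.
- by move=> x /ix[].
- by move=> x /iy[].
- by move=> x y x0 y0; rewrite (le_trans (Im_le_normc _))// KA.
- by move=> x /ix[].
- by move=> x /iy[].
Qed.

End ComplexIntegral.

(** * The gamma function *)

Section RealKernels.
Context {R : realType}.
Local Notation mu := (@lebesgue_measure R).
Local Notation D0 := (`]0%R, +oo[%classic : set R).
Implicit Types (f F : R -> R) (s t x : R).

Let mD0 : measurable (D0 : set (measurableTypeR R)). Proof. exact: measurable_itv. Qed.

Lemma continuous_pos_rpow s : continuous_pos (fun t : R => expR (s * ln t)).
Proof.
apply: continuous_pos_expR => x x0; apply: cvgM; first exact: cst_continuous.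
exact: continuous_ln.
Qed.

Lemma is_derive_rpow s t : 0 < t ->
  is_derive t 1 (fun t => expR (s * ln t)) (s * expR ((s - 1) * ln t)).
Proof.
move=> t0.
have h1 : is_derive t 1 (fun t => s * ln t) (s / t).
  have := @is_deriveZ _ _ _ (@ln R) s t 1 t^-1 (is_derive1_ln t0).
  by [].
have := @is_derive1_comp _ expR (fun t => s * ln t) t _ _ (is_derive_expR _) h1.
congr (is_derive _ _ _ _).
by rewrite mulrBl mul1r expRB lnK// mulrCA mulrA.
Qed.

Lemma ln_le_sub1 x : 0 < x -> ln x <= x - 1.
Proof.
move=> x0; rewrite -[in leLHS](subrK 1 x) addrC; apply: le_ln1Dx.
by rewrite ltrBrDl subrr.
Qed.

(** A power is a lower-order term against half of the exponential decay of the
    gamma kernel: the logarithm lies below its tangent at [2 s]. *)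
Lemma rpow_le_expR s t : 0 < s -> 0 < t ->
  expR (s * ln t) <= expR (s * ln (2 * s)) * expR (t / 2).
Proof.
move=> s0 t0; have s20 : 0 < 2 * s by rewrite mulr_gt0.
have := ln_le_sub1 (divr_gt0 t0 s20); rewrite ln_div// => h.
rewrite -expRD ler_expR; have := ler_wpM2l (ltW s0) h.
have -> : s * (t / (2 * s) - 1) = t / 2 - s by field; rewrite gt_eqF.
rewrite mulrBr; lra.
Qed.

Let continuous_inv_sq u : 0 <= u -> {for u, continuous (fun u : R => (1 + u) ^- 2)}.
Proof.
move=> u0; have -> : (fun u : R => (1 + u) ^- 2) = (fun u => (1 + u)^-1 * (1 + u)^-1).
  by apply/funext => v; rewrite -invfM -expr2.
have h : {for u, continuous (fun u : R => (1 + u)^-1)}.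
  apply: cvgV; first by rewrite gt_eqF// ltr_wpDr.
  by apply: cvgD; [exact: cst_continuous|exact: cvg_id].
exact: cvgM.
Qed.

Let integrable_inv_sq : mu.-integrable D0 (EFin \o (fun u : R => (1 + u) ^- 2)).
Proof.
have csq := continuous_inv_sq.
apply/integrableP; split.
  apply/measurable_EFinP; apply: continuous_pos_measurable => u u0.
  exact/csq/ltW.
under eq_integral do rewrite /= ger0_norm ?invr_ge0 ?sqr_ge0//.
have dF (x : R) : 0 <= x -> is_derive x 1 (fun u : R => - (1 + u)^-1) ((1 + x) ^- 2).
  move=> x0.
  have n0 : 1 + x != 0 by rewrite gt_eqF// ltr_wpDr.
  have h : is_derive x 1 (fun u : R => 1 + u) 1.
    have := is_deriveD (is_derive_cst (1 : R) x 1) (is_derive_id x 1).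
    by rewrite add0r.
  have := is_deriveN (is_deriveV n0 h).
  by rewrite /GRing.scale /= mulr1 opprK.
rewrite (@integral_itv_obnd_cbnd R 0 +oo%O (fun u => ((1 + u) ^- 2)%:E)); last first.
  by apply/measurable_EFinP; apply: continuous_pos_measurable => u u0; exact/csq/ltW.
rewrite (@ge0_continuous_FTC2y R (fun u => (1 + u) ^- 2)
  (fun u => - (1 + u)^-1) 0 0) ?ltry//.
- by move=> x _; rewrite invr_ge0 sqr_ge0.
- apply: continuous_in_subspaceT => x; rewrite inE/= in_itv/= andbT.
  exact: csq.
- rewrite -[X in _ --> X]oppr0; apply: cvgN.
  apply/cvgrPdist_le => e e0; near=> x.
  have x0 : 0 < x by near: x; exact: nbhs_pinfty_gt.
  rewrite sub0r normrN gtr0_norm ?invr_gt0 ?addr_gt0// -[leRHS]invrK.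
  rewrite lef_pV2 ?posrE ?invr_gt0 ?addr_gt0//.
  apply: (@le_trans _ _ x); last by rewrite lerDr.
  by near: x; apply: nbhs_pinfty_ge; rewrite num_real.
- by move=> x x0; have [] := dF x (ltW x0).
- apply: cvg_at_right_filter; apply: cvgN; apply: cvgV.
    by rewrite addr0 oner_neq0.
  by apply: cvgD; [exact: cvg_cst|exact: cvg_id].
- move=> x; rewrite in_itv/= andbT => x0.
  by rewrite derive1E; have [_ ->] := dF x (ltW x0).
Unshelve. all: by end_near. Qed.

(** The comparison function is, up to a constant, the derivative
    [s t^(s - 1) / (1 + t^s)^2] of the bounded function [t^s / (1 + t^s)], which
    handles the singularity at 0 and the decay at infinity together.  It is
    integrable as the image of [1 / (1 + u)^2] under [u = t^s]. *)
Lemma gamma_kernel_integrable s : 0 < s ->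
  mu.-integrable D0 (EFin \o (fun t => expR ((s - 1) * ln t) * expR (- t))).
Proof.
move=> s0.
pose phi t := expR (s * ln t); pose dphi t := s * expR ((s - 1) * ln t).
have ch := @ge0_change_of_variables R phi dphi (fun u => (1 + u) ^- 2).
have cinv : continuous_pos (fun u : R => (1 + u) ^- 2).
  by move=> u u0; exact/continuous_inv_sq/ltW.
have cdphi : continuous_pos dphi.
  by move=> x x0; apply: cvgM; [exact: cst_continuous|exact: continuous_pos_rpow].
have cphi : continuous_pos phi by exact: continuous_pos_rpow.
have dphi0 x : 0 < x -> 0 < dphi x by move=> _; rewrite mulr_gt0// expR_gt0.
have ccomp : continuous_pos (fun x => (1 + phi x) ^- 2 * dphi x).
  move=> x x0; apply: cvgM; last exact: cdphi.
  apply: (@continuous_comp _ _ _ phi (fun u => (1 + u) ^- 2)); first exact: cphi.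
  by apply: cinv; exact: expR_gt0.
have i1 : mu.-integrable D0 (EFin \o (fun x => (1 + phi x) ^- 2 * dphi x)).
  apply/integrableP; split.
    by apply/measurable_EFinP; exact: continuous_pos_measurable.
  have /integrableP[_] := integrable_inv_sq; congr (_ < _)%E.
  under eq_integral do rewrite /= ger0_norm ?invr_ge0 ?sqr_ge0//.
  rewrite (ch (fun x => @is_derive_rpow s x))//.
  - apply: eq_integral => x; rewrite half_lineP => x0 /=.
    by rewrite ger0_norm// mulr_ge0 ?invr_ge0 ?sqr_ge0// ltW// dphi0.
  - by move=> x _; exact: expR_gt0.
  - move=> y y0; exists (expR (s^-1 * ln y)); first exact: expR_gt0.
    by rewrite /phi expRK mulrA mulfV ?gt_eqF// mul1r lnK.
  - by move=> x _; rewrite invr_ge0 sqr_ge0.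
(* The constant comes from [exp (- t / 2) (1 + t^s) <= 1 + (2 s)^s], squared. *)
pose C := (1 + expR (s * ln (2 * s))) ^+ 2 / s.
have i2 := integrableZl mD0 C i1.
apply: le_integrable i2 => //.
  apply/measurable_EFinP; apply: continuous_pos_measurable => x x0.
  apply: cvgM; first exact: continuous_pos_rpow.
  by apply: (continuous_pos_expR (h := -%R)) => // y y0; exact: cvgN.
move=> t /D0P t0 /=; rewrite lee_fin ger0_norm ?mulr_ge0 ?expR_ge0//.
apply: le_trans (ler_norm _).
have -> : C * ((1 + phi t) ^- 2 * dphi t) = expR ((s - 1) * ln t) *
    ((1 + expR (s * ln (2 * s))) ^+ 2 / (1 + phi t) ^+ 2).
  rewrite /C /dphi.
  have sn : s != 0 by rewrite gt_eqF.
  have qn : 1 + phi t != 0 by rewrite gt_eqF// addr_gt0// expR_gt0.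
  by field; rewrite sn qn.
rewrite ler_wpM2l ?expR_ge0//.
rewrite ler_pdivlMr ?exprn_gt0 ?addr_gt0 ?expR_gt0//.
have -> : expR (- t) = expR (- (t / 2)) ^+ 2.
  by rewrite -expRM_natl; congr expR; field.
rewrite -exprMn ler_pXn2r ?nnegrE ?mulr_ge0 ?addr_ge0 ?expR_ge0//.
rewrite mulrDr mulr1 lerD//; first by rewrite expR_le1 oppr_le0 divr_ge0// ltW.
rewrite expRN mulrC ler_pdivrMr ?expR_gt0//; exact: rpow_le_expR.
Qed.

(** The integrals over [[1 / (N + 1), N + 1]] converge to the integral over the
    half-line by monotone convergence of the positive and negative parts;
    integrability keeps their difference from being a difference of
    infinities. *)
Lemma half_line_FTC F f l0 l1 :
  (forall x : R, 0 < x -> is_derive x 1 F (f x)) -> continuous_pos f ->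
  mu.-integrable D0 (EFin \o f) ->
  F (N.+1%:R)^-1 @[N --> \oo] --> l0 -> F N.+1%:R @[N --> \oo] --> l1 ->
  \int[mu]_(x in D0) f x = l1 - l0.
Proof.
move=> dF cf intf F0 F1.
have cF : continuous_pos F.
  move=> x x0; apply: differentiable_continuous; apply/derivable1_diffP.
  by case: (dF x x0).
pose I N : set R := `[(N.+1%:R)^-1, N.+1%:R]%classic.
have exh (g : R -> R) : continuous_pos g -> (forall x : R, 0 < x -> 0 <= g x) ->
    (\int[mu]_(x in I N) (g x)%:E)%E @[N --> \oo] --> (\int[mu]_(x in D0) (g x)%:E)%E.
  move=> cg g0; apply: (@cvg_exhaust R id g) => //.
  - by move=> y y0; exists y.
  - exact: continuous_pos_measurable.
have max0 (g : R -> R) x : 0 < x -> 0 <= Num.max (g x) 0 by rewrite le_max lexx orbT.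
have Lp := exh _ (continuous_pos_max0 cf) (max0 _).
have cNf : continuous_pos (fun x => - f x).
  by move=> x x0; apply: cvgN; exact: cf.
have Ln := exh _ (continuous_pos_max0 cNf) (max0 _).
have L : (\int[mu]_(x in I N) (f x)%:E)%E @[N --> \oo]
    --> (\int[mu]_(x in D0) (f x)%:E)%E.
  rewrite integralE funepos_max funeneg_max.
  under eq_fun do rewrite integralE funepos_max funeneg_max.
  apply: cvgeB => //; rewrite fin_num_adde_defl//.
  rewrite -funeneg_max fin_numN; exact: (integrable_neg_fin_num mD0 intf).
have FTC N : (\int[mu]_(x in I N) (f x)%:E)%E = (F N.+1%:R - F (N.+1%:R)^-1)%:E.
  have N0 : 0 < N.+1%:R^-1 :> R by rewrite invr_gt0 ltr0n.
  have : (N.+1%:R)^-1 <= N.+1%:R :> R by rewrite (le_trans (y := 1))// ?invf_le1// ler1n.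
  rewrite le_eqVlt => /predU1P[e|lt].
    by rewrite /I e set_itv1 integral_set1 subrr.
  rewrite /I (@continuous_FTC2 _ f F)//.
  - exact: continuous_pos_within.
  - split.
    + move=> x; rewrite in_itv/= => /andP[ux _].
      by have [] := dF x (lt_trans N0 ux).
    + exact: cvg_at_right_filter (cF _ N0).
    + exact: cvg_at_left_filter (cF _ (ltr0Sn _ N)).
  - move=> x; rewrite in_itv/= => /andP[ux _].
    by rewrite derive1E; have [_ ->] := dF x (lt_trans N0 ux).
have L' : fine (\int[mu]_(x in I N) (f x)%:E)%E @[N --> \oo] --> \int[mu]_(x in D0) f x.
  apply: (@fine_cvg _ _ _ _ (fun N => \int[mu]_(x in I N) (f x)%:E)%E).
  by rewrite fineK//; exact: integrable_fin_num intf.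
have L2 : F N.+1%:R - F (N.+1%:R)^-1 @[N --> \oo] --> \int[mu]_(x in D0) f x.
  move: L'; rewrite (_ : (fun N => fine _) = (fun N => F N.+1%:R - F (N.+1%:R)^-1))//.
  by apply/funext => N; rewrite FTC.
by apply: cvg_unique L2 _ => //; apply: cvgB.
Qed.

End RealKernels.

Section Gamma.
Context {R : realType}.
Local Notation mu := (@lebesgue_measure R).
Local Notation D0 := (`]0%R, +oo[%classic : set R).
Local Notation Re := (@complex.Re R).
Local Notation Im := (@complex.Im R).
Implicit Types (z w : R[i]) (s t x : R).

Definition gamma_kernel z t : R[i] := cpow t (z - 1) * (expR (- t))%:C.

Lemma normc_gamma_kernel z t :
  normc (gamma_kernel z t) = expR ((Re z - 1) * ln t) * expR (- t).
Proof.
rewrite /gamma_kernel ComplexField.Normc.normcM normc_cpow normc_real ?expR_ge0//.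
by rewrite ReB.
Qed.

Lemma continuous_pos_expRN : continuous_pos (fun t : R => expR (- t)).
Proof. by apply: continuous_pos_expR => x _; apply: cvgN; exact: cvg_id. Qed.

Lemma gamma_kernel_continuous z : ccontinuous (gamma_kernel z).
Proof.
apply: ccontinuousM; last exact: (ccontinuous_real continuous_pos_expRN).
by apply: ccontinuous_cpow => // x _; exact: cvg_id.
Qed.

Lemma gamma_kernel_cintegrable z : 0 < Re z -> cintegrable D0 (gamma_kernel z).
Proof.
move=> z0; apply: cintegrable_dominated (gamma_kernel_integrable z0).
  exact: (ccontinuous_measurable (gamma_kernel_continuous z)).
by move=> x _; rewrite normc_gamma_kernel.
Qed.

Lemma is_derive_cexp (h : R -> R[i]) t (d : R[i]) :
  is_derive t 1 (fun x => Re (h x)) (Re d) ->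
  is_derive t 1 (fun x => Im (h x)) (Im d) ->
  is_derive t 1 (fun x => Re (cexp (h x))) (Re (d * cexp (h t))) /\
  is_derive t 1 (fun x => Im (cexp (h x))) (Im (d * cexp (h t))).
Proof.
move=> dR dI.
have de := @is_derive1_comp _ expR (fun x => Re (h x)) t _ _ (is_derive_expR _) dR.
have dc := @is_derive1_comp _ cos (fun x => Im (h x)) t _ _ (is_derive_cos _) dI.
have ds := @is_derive1_comp _ sin (fun x => Im (h x)) t _ _ (is_derive_sin _) dI.
have d1 := is_deriveM de dc; have d2 := is_deriveM de ds.
split.
  have -> : (fun x => Re (cexp (h x))) =
      (expR \o (fun x => Re (h x))) * (cos \o (fun x => Im (h x))).
    by apply/funext => x; rewrite cexpE.
  apply: (is_derive_eq d1); rewrite ReM !cexpE /GRing.scale /=; ring.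
have -> : (fun x => Im (cexp (h x))) =
    (expR \o (fun x => Re (h x))) * (sin \o (fun x => Im (h x))).
  by apply/funext => x; rewrite cexpE.
apply: (is_derive_eq d2); rewrite ImM !cexpE /GRing.scale /=; ring.
Qed.

(** The primitive used for the integration by parts, [t^z exp (- t)], is a
    single exponential. *)
Let primitiveE z t : cpow t z * (expR (- t))%:C = cexp (z * (ln t)%:C - t%:C).
Proof. by rewrite cexpD -[- t%:C](rmorphN (real_complex R)) cexp_real. Qed.

Let is_derive_primitive z t : 0 < t ->
  is_derive t 1 (fun t => Re (cexp (z * (ln t)%:C - t%:C)))
    (Re (z * gamma_kernel z t - gamma_kernel (z + 1) t)) /\
  is_derive t 1 (fun t => Im (cexp (z * (ln t)%:C - t%:C)))
    (Im (z * gamma_kernel z t - gamma_kernel (z + 1) t)).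
Proof.
move=> t0.
have dln k : is_derive t 1 (fun t => k * ln t) (k / t).
  exact: (@is_deriveZ _ _ _ (@ln R) k t 1 t^-1 (is_derive1_ln t0)).
have -> : z * gamma_kernel z t - gamma_kernel (z + 1) t =
    (z * t^-1%:C - 1) * cexp (z * (ln t)%:C - t%:C).
  rewrite -primitiveE /gamma_kernel addrK cpowB cpow1//.
  rewrite fmorphV/=; field.
  by rewrite (fmorph_eq0 (real_complex R)) gt_eqF.
apply: is_derive_cexp.
  have -> : (fun x => Re (z * (ln x)%:C - x%:C)) =
      (fun x => Re z * ln x) - (id : R -> R).
    by apply/funext => x; rewrite ReB ReZr.
  have := is_deriveB (dln (Re z)) (is_derive_id t 1).
  by rewrite ReB ReZr.
have -> : (fun x => Im (z * (ln x)%:C - x%:C)) = (fun x => Im z * ln x).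
  by apply/funext => x; rewrite ImD ImZr /= oppr0 addr0.
by rewrite ImD ImZr /= oppr0 addr0.
Qed.

Let boundary_zero s : 0 < s ->
  expR (s * ln (N.+1%:R^-1)) * expR (- (N.+1%:R^-1)) @[N --> \oo] --> (0 : R) /\
  expR (s * ln N.+1%:R) * expR (- N.+1%:R) @[N --> \oo] --> (0 : R).
Proof.
move=> s0; split.
  apply/cvgrPdist_le => e e0; near=> N.
  have N0 : 0 < N.+1%:R :> R by [].
  rewrite sub0r normrN ger0_norm ?mulr_ge0 ?expR_ge0//.
  apply: (@le_trans _ _ (expR (s * ln (N.+1%:R^-1)))).
    by rewrite ler_piMr ?expR_ge0// expR_le1 oppr_le0 invr_ge0.
  rewrite lnV ?posrE// -[leRHS](lnK e0) ler_expR mulrN lerNl -ler_pdivrMl// mulrC.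
  rewrite -[leLHS]expRK ler_ln ?posrE ?expR_gt0//.
  rewrite (le_trans _ (_ : N%:R <= _))// ?ler_nat//.
  by near: N; exact: nbhs_infty_ger.
have h : expR (s * ln (2 * s)) * (2 * harmonic N) @[N --> \oo] --> (0 : R).
  rewrite -[X in _ --> X](mulr0 (expR (s * ln (2 * s)))).
  apply: cvgMr; rewrite -[X in _ --> X](mulr0 2); apply: cvgMr; exact: cvg_harmonic.
apply: squeeze_cvgr (cvg_cst 0) h; apply: nearW => N.
have N0 : 0 < N.+1%:R :> R by [].
rewrite mulr_ge0 ?expR_ge0//=.
have -> : expR (- N.+1%:R) = expR (- (N.+1%:R / 2)) * expR (- (N.+1%:R / 2)) :> R.
  by rewrite -expRD; congr expR; field.
rewrite mulrA ler_pM ?mulr_ge0 ?expR_ge0//.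
  by rewrite expRN ler_pdivrMr ?expR_gt0//; exact: rpow_le_expR.
rewrite expRN /harmonic/= -[2 * _]invrK lef_pV2 ?posrE ?expR_gt0//.
  by rewrite invfM invrK mulrC (le_trans _ (expR_ge1Dx _))// lerDr.
Unshelve. all: by end_near. Qed.

(** The derivative of [t^z exp (- t)] is the difference of the kernels of the
    two sides, and this function vanishes at both ends of the half-line. *)
Lemma euler_integralS z : 0 < Re z ->
  euler_integral (z + 1) = z * euler_integral z.
Proof.
move=> z0.
have z10 : 0 < Re (z + 1) by rewrite ReD Re1 addr_gt0.
have [iz ez] := cintegralZ z (gamma_kernel_cintegrable z0).
have [i e] := cintegral_linear (-1) (gamma_kernel_cintegrable z10) iz.
pose f t := z * gamma_kernel z t - gamma_kernel (z + 1) t.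
have fE t : -1 * gamma_kernel (z + 1) t + z * gamma_kernel z t = f t.
  by rewrite mulN1r addrC.
have cf : ccontinuous f.
  have c1 := gamma_kernel_continuous (z + 1).
  apply: eq_ccontinuous (ccontinuousD (ccontinuousM (ccontinuous_cst (-1)) c1)
    (ccontinuousM (ccontinuous_cst z) (gamma_kernel_continuous z))).
  by move=> x _; rewrite fE.
have [iR iI] : cintegrable D0 f by apply: eq_cintegrable i => x _; rewrite fE.
have [b0 b1] := boundary_zero z0.
have nF t : normc (cexp (z * (ln t)%:C - t%:C)) = expR (Re z * ln t) * expR (- t).
  by rewrite normc_cexp ReB ReZr expRD.
have sq (p : R[i] -> R) : (forall w, `|p w| <= normc w) -> forall u : nat -> R,
    expR (Re z * ln (u N)) * expR (- u N) @[N --> \oo] --> (0 : R) ->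
    p (cexp (z * (ln (u N))%:C - (u N)%:C)) @[N --> \oo] --> (0 : R).
  move=> pn u u0; apply: norm_cvg0; apply: squeeze_cvgr (cvg_cst 0) u0.
  by apply: nearW => N; rewrite normr_ge0/= -nF.
have z2 : cintegral D0 f = 0.
  apply: complex_eqP; rewrite /cintegral/=.
    rewrite (half_line_FTC (fun _ px => (is_derive_primitive z px).1) cf.1 iR
      (sq _ (@Re_le_normc R) _ b0) (sq _ (@Re_le_normc R) _ b1)).
    by rewrite subrr.
  rewrite (half_line_FTC (fun _ px => (is_derive_primitive z px).2) cf.2 iI
    (sq _ (@Im_le_normc R) _ b0) (sq _ (@Im_le_normc R) _ b1)).
  by rewrite subrr.
have : cintegral D0 f = -1 * euler_integral (z + 1) + z * euler_integral z.
  by rewrite -ez -e; apply: eq_cintegral => x _; rewrite fE.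
by rewrite z2 mulN1r addrC => /esym/eqP; rewrite subr_eq0 => /eqP.
Qed.

Lemma euler_integral_shift z N : 0 < Re z ->
  euler_integral (z + N%:R) = (\prod_(i < N) (z + i%:R)) * euler_integral z.
Proof.
move=> z0; elim: N => [|N IH]; first by rewrite addr0 big_ord0 mul1r.
rewrite -natr1 addrA euler_integralS; last by rewrite ReD Re_nat ltr_wpDr.
by rewrite IH big_ord_recr/= mulrA [_ * (z + _)]mulrC.
Qed.

Lemma Re_gamma_kernel_real s t :
  Re (gamma_kernel s%:C t) = expR ((s - 1) * ln t) * expR (- t).
Proof.
rewrite /gamma_kernel -[1 : R[i]]/((1 : R)%:C).
by rewrite -[s%:C - _](rmorphB (real_complex R)) cpow_real -rmorphM.
Qed.

(** On [[1, 2]] the kernel is at least [exp (- 2)], and it is nonnegative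
    elsewhere. *)
Let euler_integral_real_ge1 s : 1 <= s -> 0 < Re (euler_integral s%:C).
Proof.
move=> s1; rewrite /euler_integral /cintegral.
have s0 : 0 < Re s%:C by rewrite /= (lt_le_trans _ s1).
have [iR _] := gamma_kernel_cintegrable s0.
have m12 : mu (`[1%R, 2%R]%classic : set R) = 1%E.
  rewrite lebesgue_measure_itv/= lte_fin ltr1n -EFinB; congr (_%:E); ring.
have h : ((expR (-2))%:E <= \int[mu]_(x in D0) (Re (gamma_kernel s%:C x))%:E)%E.
  have -> : ((expR (-2))%:E =
      \int[mu]_(x in `[1%R, 2%R]) (cst (expR (-2))%:E x))%E.
    rewrite integral_cst; last exact: measurable_itv.
    by rewrite -[LHS]mule1; congr (_ * _)%E; rewrite -m12.
  apply: (@le_trans _ _ (\int[mu]_(x in `[1%R, 2%R])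
      (Re (gamma_kernel s%:C x))%:E)%E).
    apply: ge0_le_integral => //.
    - by move=> x _; rewrite lee_fin expR_ge0.
    - apply/measurable_EFinP.
      apply: (@measurable_funS _ _ _ _ D0) => //.
        by move=> x /=; rewrite !in_itv/= andbT => /andP[+ _]; exact: lt_le_trans.
      exact: (ccontinuous_measurable (gamma_kernel_continuous s%:C)).1.
    - move=> x xI; have /andP[x1 x2] : 1 <= x <= 2 by move: xI; rewrite /= in_itv.
      rewrite lee_fin Re_gamma_kernel_real.
      rewrite -expRD ler_expR -[leLHS]add0r lerD ?lerN2//.
      by rewrite mulr_ge0 ?subr_ge0// ln_ge0.
  apply: ge0_subset_integral => //.
  - exact: measurable_int iR.
  - by move=> x _; rewrite lee_fin Re_gamma_kernel_real mulr_ge0 ?expR_ge0.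
  - by move=> x /=; rewrite !in_itv/= andbT => /andP[+ _]; exact: lt_le_trans.
rewrite /Rintegral -lte_fin fineK; last exact: integrable_fin_num iR.
by apply: lt_le_trans h; rewrite lte_fin expR_gt0.
Qed.

Lemma euler_integral_real_gt0 s : 0 < s -> 0 < Re (euler_integral s%:C).
Proof.
move=> s0; have := @euler_integral_real_ge1 (s + 1).
rewrite (rmorphD (real_complex R)) euler_integralS// ReZ pmulr_rgt0//; apply.
by rewrite lerDr ltW.
Qed.

(** The constants in this bound and in the next one are not optimal; together
    they bound a cosine of a logarithm from below by powers of [t], whose
    integrals against the gamma kernel are given by the recursion. *)
Lemma cos_ge x : 1 - x ^+ 2 <= cos x.
Proof.
have sin_le (y : R) : 0 <= y -> `|sin y| <= y.
  rewrite le_eqVlt => /predU1P[<-|y0]; first by rewrite sin0 normr0.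
  have [|c _] := @MVT _ sin cos 0 y y0 (fun u _ => is_derive_sin u).
    by apply: continuous_subspaceT; exact: continuous_sin.
  rewrite sin0 !subr0 => ->; rewrite normrM (gtr0_norm y0) ler_piMl ?(ltW y0)//.
  by rewrite ler_norml cos_le1 cos_geN1.
have sin_le' (y : R) : sin y ^+ 2 <= y ^+ 2.
  rewrite -(real_normK (num_real (sin y))) -(real_normK (num_real y)).
  rewrite ler_pXn2r ?nnegrE//.
  have [y0|y0] := leP 0 y; first by rewrite (ger0_norm y0) sin_le.
  by rewrite (ltr0_norm y0) -normrN -sinN sin_le// oppr_ge0 ltW.
have -> : x = x / 2 + x / 2 by field.
rewrite cosD -!expr2; have := cos2Dsin2 (x / 2); have := sin_le' (x / 2); nra.
Qed.

(** With [v = ln (t / s)] the right-hand side is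
    [4 (t / s + s / t - 2)]. *)
Lemma sqr_le_expR (v : R) : v ^+ 2 <= 4 * (expR v + expR (- v) - 2).
Proof.
wlog v0 : v / 0 <= v.
  move=> h; have [/h//|/ltW v0] := leP 0 v.
  by have := h (- v); rewrite oppr_ge0 sqrrN opprK [expR (- v) + _]addrC; exact.
have e1 := expR_ge1Dx (v / 2).
have e2 : expR (- (v / 2)) <= 1 by rewrite expR_le1 oppr_le0 divr_ge0.
have e12 : expR (v / 2) * expR (- (v / 2)) = 1 by rewrite -expRD subrr expR0.
have -> : expR v = expR (v / 2) ^+ 2 by rewrite -expRM_natl; congr expR; field.
have -> : expR (- v) = expR (- (v / 2)) ^+ 2.
  by rewrite -expRM_natl; congr expR; field.
nra.
Qed.

(** For [z = s + i tau] with [s] large, the real kernel [t^(s - 1) exp (- t)]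
    concentrates around [t = s], so that the phase [t^(i tau)] is nearly
    [s^(i tau)].  After division by this value, the real part of the integral is
    that of the real kernel times [cos (tau ln (t / s))], which is at least
    [1 - k (t / s + s / t - 2)] with [k = 4 tau^2].  By the recursion, the
    integral of the kernel times this lower bound is
    [(s - 1 - k) Gamma (s - 1)], which is positive. *)
Lemma euler_integral_neq0_large z :
  1 + 4 * Im z ^+ 2 < Re z -> euler_integral z != 0.
Proof.
move=> zlarge; set s := Re z in zlarge; set tau := Im z in zlarge.
have tau2 : 0 <= tau ^+ 2 by rewrite sqr_ge0.
have s1 : 1 < s by lra.
have s0 : 0 < s by lra.
pose g x := Re (euler_integral x%:C).
have gS x : 0 < x -> g (x + 1) = x * g x.
  by move=> x0; rewrite /g -ReZ -euler_integralS// (rmorphD (real_complex R)).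
pose G := g (s - 1).
have gs : g s = (s - 1) * G by rewrite -gS ?subrK// subr_gt0.
have gs1 : g (s + 1) = s * ((s - 1) * G) by rewrite gS// gs.
have gs0 : 0 < g s by exact: euler_integral_real_gt0.
have G0 : 0 < G by move: gs0; rewrite gs pmulr_rgt0// subr_gt0.
pose w := cpow s (- (0 +i* tau)).
apply/eqP => z_eq0.
have [iw ew] := cintegralZ w (gamma_kernel_cintegrable (s0 : 0 < Re z)).
have ik x : 0 < x -> mu.-integrable D0 (EFin \o (fun t => Re (gamma_kernel x%:C t))).
  by move=> x0; have [] := gamma_kernel_cintegrable (x0 : 0 < Re x%:C).
pose k := 4 * tau ^+ 2.
have [sp sm] : 0 < s + 1 /\ 0 < s - 1 by rewrite subr_gt0 addr_gt0.
pose low t := (1 + 2 * k) * Re (gamma_kernel s%:C t) -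
  k / s * Re (gamma_kernel (s + 1)%:C t) - k * s * Re (gamma_kernel (s - 1)%:C t).
have [i1 e1] := integrable_linear (1 + 2 * k) (- (k / s)) (ik s s0) (ik _ sp).
have [i2 e2] := integrable_linear 1 (- (k * s)) i1 (ik _ sm).
have lowE : (fun t => 1 * ((1 + 2 * k) * Re (gamma_kernel s%:C t) +
    - (k / s) * Re (gamma_kernel (s + 1)%:C t)) +
    - (k * s) * Re (gamma_kernel (s - 1)%:C t)) = low.
  by apply/funext => t; rewrite /low mul1r !mulNr.
rewrite lowE in i2 e2; rewrite e1 in e2.
have low0 : 0 < \int[mu]_(t in D0) low t.
  have -> : \int[mu]_(t in D0) low t =
      (1 + 2 * k) * g s - k / s * g (s + 1) - k * s * g (s - 1).
    by rewrite e2 mul1r !mulNr.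
  rewrite gs1 gs -/G; have -> : (1 + 2 * k) * ((s - 1) * G) -
     k / s * (s * ((s - 1) * G)) - k * s * G = G * (s - 1 - k).
    by field; rewrite gt_eqF.
  by rewrite mulr_gt0// -addrA -opprD subr_gt0.
have : \int[mu]_(t in D0) low t <= \int[mu]_(t in D0) Re (w * gamma_kernel z t).
  apply: le_Rintegral => //; first by case: iw.
  move=> t /D0P t0.
  pose K := expR ((s - 1) * ln t) * expR (- t).
  have K0 : 0 <= K by rewrite mulr_ge0 ?expR_ge0.
  pose v := ln t - ln s.
  have ev : expR v = t / s by rewrite expRB !lnK.
  have evN : expR (- v) = s / t by rewrite opprB expRB !lnK.
  have -> : Re (w * gamma_kernel z t) = K * cos (tau * v).
    rewrite /gamma_kernel mulrA ReZr /w /cpow -cexpD cexpE/=.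
    rewrite ReD ImD !ReZr !ImZr ReB ImD /= oppr0 mul0r add0r addr0.
    rewrite /K /v mulrBr mulNr -/s -/tau [- _ + _]addrC; ring.
  have -> : low t = K * ((1 + 2 * k) - k * (t / s) - k * (s / t)).
    have Kp : Re (gamma_kernel (s + 1)%:C t) = K * t.
      rewrite Re_gamma_kernel_real /K addrK.
      have -> : s * ln t = (s - 1) * ln t + ln t by ring.
      by rewrite expRD lnK//; ring.
    have Km : Re (gamma_kernel (s - 1)%:C t) = K / t.
      rewrite Re_gamma_kernel_real /K.
      have -> : (s - 1 - 1) * ln t = (s - 1) * ln t - ln t by ring.
      by rewrite expRB lnK//; ring.
    rewrite /low Re_gamma_kernel_real -/K Kp Km; field; rewrite (gt_eqF s0) gt_eqF//.
  apply: ler_wpM2l => //; apply: le_trans (cos_ge _).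
  have h := sqr_le_expR v; rewrite ev evN in h.
  have -> : 1 + 2 * k - k * (t / s) - k * (s / t) =
      1 - tau ^+ 2 * (4 * (t / s + s / t - 2)) by rewrite /k; ring.
  by rewrite lerB// exprMn ler_wpM2l.
have -> : \int[mu]_(t in D0) Re (w * gamma_kernel z t) = 0.
  rewrite -[LHS]/(Re (cintegral D0 (fun t => w * gamma_kernel z t))) ew.
  by rewrite -[cintegral _ _]/(euler_integral z) z_eq0 mulr0.
by rewrite leNgt low0.
Qed.

(** By the recursion, a zero of Euler's integral would produce zeros at all its
    shifts to the right. *)
Lemma euler_integral_neq0 z : 0 < Re z -> euler_integral z != 0.
Proof.
move=> z0; pose N := (Num.truncn (1 + 4 * Im z ^+ 2)).+1.
have : euler_integral (z + N%:R) != 0.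
  apply: euler_integral_neq0_large.
  rewrite ReD ImD Re_nat Im_nat addr0 ltr_wpDl//; first exact: ltW.
  exact: truncnS_gt.
by rewrite euler_integral_shift// mulf_eq0 negb_or => /andP[].
Qed.

Lemma cgammaE z : 0 < Re z -> cgamma z = euler_integral z.
Proof. by rewrite /cgamma => ->. Qed.

Lemma not_pole_neq0 z i : ~ gamma_pole z -> z + i%:R != 0.
Proof.
by move=> np; apply/eqP => zi; apply: np; exists i; apply/eqP; rewrite -addr_eq0 zi.
Qed.

Lemma pos_not_pole z : 0 < Re z -> ~ gamma_pole z.
Proof.
by move=> z0 [m zm]; move: z0; rewrite zm ReN Re_nat oppr_gt0 ltrn0.
Qed.

(** The values of the continuation at [z] and [z + 1] are defined with different
    shifts; they can be compared since every shift to the right half-plane gives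
    the same value. *)
Lemma cgamma_shift z N : ~ gamma_pole z -> 0 < Re (z + N%:R) ->
  cgamma z * \prod_(i < N) (z + i%:R) = euler_integral (z + N%:R).
Proof.
move=> np zN; rewrite /cgamma; case: ifPn => [z0|].
  by rewrite euler_integral_shift// mulrC.
rewrite -leNgt => z0; set m := (Num.truncn _).+1.
have zm : 0 < Re (z + m%:R).
  by rewrite ReD Re_nat -ltrBlDl sub0r truncnS_gt.
have mN : (m <= N)%N.
  rewrite /m -(ltr_nat R) (le_lt_trans (y := - Re z))//.
    by rewrite truncn_le oppr_ge0.
  by move: zN; rewrite ReD Re_nat -ltrBlDl sub0r.
rewrite -(subnK mN) [(_ + m)%N]addnC natrD addrA (euler_integral_shift (N - m) zm).
rewrite big_split_ord/= mulrA divfK; last first.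
  by apply/prodf_neq0 => i _; exact: not_pole_neq0.
by rewrite mulrC; congr (_ * _); apply: eq_bigr => i _; rewrite natrD addrA.
Qed.

Lemma prod_shift_neq0 z N : ~ gamma_pole z -> \prod_(i < N) (z + i%:R) != 0.
Proof. by move=> np; apply/prodf_neq0 => i _; exact: not_pole_neq0. Qed.

Lemma exists_shift z : exists N : nat, 0 < Re (z + N%:R).
Proof.
exists (Num.truncn (- Re z)).+1.
by rewrite ReD Re_nat -ltrBlDl sub0r truncnS_gt.
Qed.

Lemma cgamma_neq0 z : ~ gamma_pole z -> cgamma z != 0.
Proof.
move=> np; have [N zN] := exists_shift z.
have := euler_integral_neq0 zN; rewrite -cgamma_shift// mulf_eq0 negb_or.
by case/andP.
Qed.

Lemma not_pole_succ z : ~ gamma_pole z -> ~ gamma_pole (z + 1).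
Proof.
move=> np [m zm]; apply: np; exists m.+1.
by rewrite -natr1 opprD -zm addrK.
Qed.

Lemma not_pole_addn z k : ~ gamma_pole z -> ~ gamma_pole (z + k%:R).
Proof.
move=> np; elim: k => [|k IH]; first by rewrite addr0.
by rewrite -natr1 addrA; exact: not_pole_succ.
Qed.

Lemma cgammaS z : ~ gamma_pole z -> cgamma (z + 1) = z * cgamma z.
Proof.
move=> np; have [N zN] := exists_shift z.
have np1 := not_pole_succ np.
have e : z + 1 + N%:R = z + N.+1%:R by rewrite -addrA nat1r.
have zN1 : 0 < Re (z + N.+1%:R).
  by rewrite -natr1 addrA ReD Re1 addr_gt0.
have h1 := cgamma_shift np zN1.
have h2 : cgamma (z + 1) * \prod_(i < N) (z + 1 + i%:R) = euler_integral (z + N.+1%:R).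
  by rewrite cgamma_shift ?e.
apply: (mulIf (prod_shift_neq0 N np1)); rewrite h2 -h1 big_ord_recl/= addr0.
rewrite mulrA [z * _]mulrC; congr (_ * _); apply: eq_bigr => i _.
by rewrite /bump/= add1n -nat1r addrA.
Qed.

End Gamma.

(** * Beta integrals *)

Section Beta.
Context {R : realType}.
Local Notation mu := (@lebesgue_measure R).
Local Notation D0 := (`]0%R, +oo[%classic : set R).
Local Notation Re := (@complex.Re R).
Local Notation Im := (@complex.Im R).
Implicit Types (z w al be : R[i]).

Let mD0 : measurable (D0 : set (measurableTypeR R)). Proof. exact: measurable_itv. Qed.

Let scale_surj (r : R) : 0 < r -> forall y : R, 0 < y -> exists2 x : R, 0 < x & r * x = y.
Proof.
move=> r0 y y0; exists (r^-1 * y); first by rewrite mulr_gt0// invr_gt0.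
by rewrite mulrA mulfV ?gt_eqF// mul1r.
Qed.

Let is_derive_scale (r x : R) : is_derive x 1 (fun x => r * x) r.
Proof.
have := @is_deriveZ _ _ _ (id : R -> R) r x 1 1 (is_derive_id x 1).
by rewrite /GRing.scale/= mulr1.
Qed.

Lemma gamma_kernel_scale z (r t : R) : 0 < r -> 0 < t ->
  r%:C * gamma_kernel z (r * t) = cpow r z * (cpow t (z - 1) * (expR (- (r * t)))%:C).
Proof.
move=> r0 t0; have -> : cpow r z = r%:C * cpow r (z - 1).
  by rewrite -(cpow1 r0) -cpowD addrC subrK.
by rewrite /gamma_kernel cpowM// -!mulrA.
Qed.

Lemma cintegral_scaled_gamma z (r : R) : 0 < Re z -> 0 < r ->
  cintegrable D0 (fun t => cpow t (z - 1) * (expR (- (r * t)))%:C) /\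
  cintegral D0 (fun t => cpow t (z - 1) * (expR (- (r * t)))%:C) =
    cpow r (- z) * euler_integral z.
Proof.
move=> z0 r0.
have cr : continuous_pos (fun _ : R => r) by move=> x _; exact: cst_continuous.
have dr (x : R) : 0 < x -> is_derive x 1 (fun x => r * x) r.
  by move=> _; exact: is_derive_scale.
have rp (x : R) : 0 < x -> 0 < r * x by move=> x0; rewrite mulr_gt0.
have gE (t : R) : 0 < t -> r%:C * gamma_kernel z (r * t) =
    cpow r z * (cpow t (z - 1) * (expR (- (r * t)))%:C).
  exact: gamma_kernel_scale.
have key := cintegral_change dr cr (fun _ _ => r0) rp (scale_surj r0)
  (gamma_kernel_continuous z).
rewrite (eq_cintegral gE) in key.
have ik := (cintegrable_change dr cr (fun _ _ => r0) rp (scale_surj r0)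
  (gamma_kernel_continuous z)).1 (gamma_kernel_cintegrable z0).
have [i1 e1] := cintegralZ (cpow r z)^-1 (eq_cintegrable gE ik).
have E t : (cpow r z)^-1 * (cpow r z * (cpow t (z - 1) * (expR (- (r * t)))%:C)) =
    cpow t (z - 1) * (expR (- (r * t)))%:C.
  by rewrite mulKf// cpow_neq0.
split; first by apply: eq_cintegrable i1 => t _; rewrite E.
rewrite cpowN -[euler_integral z]/(cintegral D0 (gamma_kernel z)) key -e1.
by apply: eq_cintegral => t _; rewrite E.
Qed.

(** Integrating this kernel over [t] gives the beta integrand in [r], while
    integrating it over [r] gives a gamma kernel in [t]. *)
Let beta_kernel al be (t r : R) : R[i] :=
  cpow t (be - 1) * cpow r (al - 1) * (expR (- ((1 + r) * t)))%:C.

Let beta_kernel_r al be (t : R) : 0 < Re al -> 0 < t ->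
  cintegrable D0 (beta_kernel al be t) /\
  cintegral D0 (beta_kernel al be t) = euler_integral al * gamma_kernel (be - al) t.
Proof.
move=> al0 t0; have [i e] := cintegral_scaled_gamma al0 t0.
have [i1 e1] := cintegralZ (cpow t (be - 1) * (expR (- t))%:C) i.
have E r : cpow t (be - 1) * (expR (- t))%:C *
    (cpow r (al - 1) * (expR (- (t * r)))%:C) = beta_kernel al be t r.
  rewrite /beta_kernel mulrDl mul1r opprD expRD rmorphM [t * r]mulrC; ring.
split; first by apply: eq_cintegrable i1 => r _; rewrite E.
have -> : cintegral D0 (beta_kernel al be t) = cintegral D0 (fun r =>
    cpow t (be - 1) * (expR (- t))%:C * (cpow r (al - 1) * (expR (- (t * r)))%:C)).
  by apply: eq_cintegral => r _; rewrite E.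
rewrite e1 e /gamma_kernel.
have -> : be - al - 1 = (be - 1) + (- al) by ring.
by rewrite [cpow t (be - 1 - al)]cpowD; ring.
Qed.

Let beta_kernel_t al be (r : R) : 0 < Re be -> 0 < r ->
  cintegrable D0 (beta_kernel al be ^~ r) /\
  cintegral D0 (beta_kernel al be ^~ r) =
    euler_integral be * (cpow r (al - 1) * cpow (1 + r) (- be)).
Proof.
move=> be0 r0; have r1 : 0 < 1 + r by rewrite addr_gt0.
have [i e] := cintegral_scaled_gamma be0 r1.
have [i1 e1] := cintegralZ (cpow r (al - 1)) i.
have E t : cpow r (al - 1) * (cpow t (be - 1) * (expR (- ((1 + r) * t)))%:C) =
    beta_kernel al be t r by rewrite /beta_kernel; ring.
split; first by apply: eq_cintegrable i1 => t _; rewrite E.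
have -> : cintegral D0 (beta_kernel al be ^~ r) = cintegral D0 (fun t =>
    cpow r (al - 1) * (cpow t (be - 1) * (expR (- ((1 + r) * t)))%:C)).
  by apply: eq_cintegral => t _; rewrite E.
by rewrite e1 e; ring.
Qed.

(** As the exponential of a measurable exponent, the kernel is jointly
    measurable on the whole plane; it need not be continuous across the axes. *)
Let beta_kernel_measurable al be :
  measurable_fun setT (fun q : R * R => Re (beta_kernel al be q.1 q.2)) /\
  measurable_fun setT (fun q : R * R => Im (beta_kernel al be q.1 q.2)).
Proof.
have lin (k l : R) (m : R * R -> R) : measurable_fun setT m ->
    measurable_fun setT (fun q : R * R => k * ln q.1 + l * ln q.2 + m q).
  move=> mm; apply: measurable_funD => //; apply: measurable_funD;
    apply: measurable_funM => //; apply: (measurableT_comp (@measurable_ln R)).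
    exact: measurable_fst.
  exact: measurable_snd.
have E q : beta_kernel al be q.1 q.2 = cexp ((be - 1) * (ln q.1)%:C +
    (al - 1) * (ln q.2)%:C + (- ((1 + q.2) * q.1))%:C).
  by rewrite /beta_kernel !cexpD cexp_real.
have mR : measurable_fun setT (fun q : R * R => Re ((be - 1) * (ln q.1)%:C +
    (al - 1) * (ln q.2)%:C + (- ((1 + q.2) * q.1))%:C)).
  rewrite (_ : (fun q : R * R => _) = (fun q => Re (be - 1) * ln q.1 +
    Re (al - 1) * ln q.2 + - ((1 + q.2) * q.1))); last first.
    by apply/funext => q; rewrite !(ReD, ReZr).
  apply: lin; apply: (measurableT_comp (@oppr_measurable R _)).
  apply: measurable_funM; last exact: measurable_fst.
  by apply: measurable_funD; [exact: measurable_cst|exact: measurable_snd].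
have mI : measurable_fun setT (fun q : R * R => Im ((be - 1) * (ln q.1)%:C +
    (al - 1) * (ln q.2)%:C + (- ((1 + q.2) * q.1))%:C)).
  rewrite (_ : (fun q : R * R => _) = (fun q => Im (be - 1) * ln q.1 +
    Im (al - 1) * ln q.2 + 0)); last first.
    by apply/funext => q; rewrite !(ImD, ImZr).
  exact: lin.
split.
  rewrite (_ : (fun q : R * R => _) = (fun q => expR (Re ((be - 1) * (ln q.1)%:C +
    (al - 1) * (ln q.2)%:C + (- ((1 + q.2) * q.1))%:C)) *
    cos (Im ((be - 1) * (ln q.1)%:C +
    (al - 1) * (ln q.2)%:C + (- ((1 + q.2) * q.1))%:C)))); last first.
    by apply/funext => q; rewrite E cexpE.
  apply: measurable_funM.
    exact: (measurableT_comp (@measurable_expR R)).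
  apply: measurableT_comp mI; apply: continuous_measurable_fun; exact: continuous_cos.
rewrite (_ : (fun q : R * R => _) = (fun q => expR (Re ((be - 1) * (ln q.1)%:C +
  (al - 1) * (ln q.2)%:C + (- ((1 + q.2) * q.1))%:C)) *
  sin (Im ((be - 1) * (ln q.1)%:C +
  (al - 1) * (ln q.2)%:C + (- ((1 + q.2) * q.1))%:C)))); last first.
  by apply/funext => q; rewrite E cexpE.
apply: measurable_funM.
  exact: (measurableT_comp (@measurable_expR R)).
apply: measurableT_comp mI; apply: continuous_measurable_fun; exact: continuous_sin.
Qed.

Let normc_beta_kernel al be (t r : R) : normc (beta_kernel al be t r) =
  expR ((Re be - 1) * ln t) * expR ((Re al - 1) * ln r) * expR (- ((1 + r) * t)).
Proof.
rewrite /beta_kernel ComplexField.Normc.normcM.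
rewrite [normc (cpow _ _ * _)]ComplexField.Normc.normcM !normc_cpow.
by rewrite normc_real ?expR_ge0// !ReB.
Qed.

Let realE (x y t r : R) :
  normc (beta_kernel x%:C y%:C t r) = Re (beta_kernel x%:C y%:C t r).
Proof.
have -> : beta_kernel x%:C y%:C t r = (expR ((y - 1) * ln t) *
    expR ((x - 1) * ln r) * expR (- ((1 + r) * t)))%:C.
  rewrite /beta_kernel -[1 : R[i]]/((1 : R)%:C) -!(rmorphB (real_complex R)).
  by rewrite !cpow_real !rmorphM.
by rewrite normc_real// !mulr_ge0 ?expR_ge0.
Qed.

(** With real exponents the kernel is positive, and its inner integral is a
    multiple of the gamma kernel with parameter [y - x]. *)
Let beta_abs_integral (x y : R) : 0 < x -> x < y ->
  (\int[mu]_(t in D0) \int[mu]_(r in D0) (normc (beta_kernel x%:C y%:C t r))%:E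
    < +oo)%E.
Proof.
move=> x0 xy; have yx : 0 < Re (y%:C - x%:C) by rewrite /= subr_gt0.
have [ig _] := gamma_kernel_cintegrable yx.
have /integrable_lty := integrableZl mD0 (Re (euler_integral x%:C)) ig.
move=> /(_ mD0); congr (_ < _)%E.
apply: eq_integral => t; rewrite half_lineP => t0.
have [[iR _] e] := beta_kernel_r y%:C (x0 : 0 < Re x%:C) t0.
transitivity (Re (cintegral D0 (beta_kernel x%:C y%:C t)))%:E.
  rewrite e -EFinM; congr (_%:E).
  rewrite /gamma_kernel -!(rmorphB (real_complex R)).
  by rewrite cpow_real -rmorphM ReZr.
rewrite Re_cintegral /Rintegral fineK; last exact: integrable_fin_num iR.
by apply: eq_integral => r _; rewrite realE.
Qed.

Let beta_integrand_continuous al be :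
  ccontinuous (fun r => cpow r (al - 1) * cpow (1 + r) (- be)).
Proof.
apply: ccontinuousM; first exact: ccontinuous_cpow_id.
apply: (@ccontinuous_cpow R (fun r => 1 + r)).
  by move=> x _; apply: cvgD; [exact: cst_continuous|exact: cvg_id].
by move=> x x0; rewrite addr_gt0.
Qed.

(** By Tonelli's theorem for the kernel with real exponents, whose other inner
    integral is a positive multiple of the modulus of the integrand. *)
Let beta_integrable al be : 0 < Re al -> Re al < Re be ->
  cintegrable D0 (fun r => cpow r (al - 1) * cpow (1 + r) (- be)).
Proof.
move=> al0 albe; have be0 := lt_trans al0 albe.
have cb := beta_integrand_continuous al be.
pose b r := normc (cpow r (al - 1) * cpow (1 + r) (- be)).
have bE r : cpow r ((Re al)%:C - 1) * cpow (1 + r) (- (Re be)%:C) = (b r)%:C.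
  have -> : (Re al)%:C - 1 = (Re al - 1)%:C by rewrite (rmorphB (real_complex R)).
  rewrite -(rmorphN (real_complex R)) !cpow_real -rmorphM.
  by rewrite /b ComplexField.Normc.normcM !normc_cpow ReB ReN.
have mb : measurable_fun D0 b.
  by have [mR mI] := ccontinuous_measurable cb; exact: measurable_normc mR mI.
have [mKR mKI] := beta_kernel_measurable (Re al)%:C (Re be)%:C.
have mK := measurable_normc mKR mKI.
have Afin := beta_abs_integral al0 albe.
rewrite half_line_tonelli in Afin; [|exact: mK|by move=> t r; exact: normc_ge0].
have iK r : 0 < r -> (\int[mu]_(t in D0)
      (normc (beta_kernel (Re al)%:C (Re be)%:C t r))%:E)%E =
    (Re (euler_integral (Re be)%:C) * b r)%:E.
  move=> r0; have [[iR _] e] := beta_kernel_t (Re al)%:C (be0 : 0 < Re (Re be)%:C) r0.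
  rewrite -ReZr -bE -e Re_cintegral /Rintegral fineK; last exact: integrable_fin_num iR.
  by apply: eq_integral => t _; rewrite realE.
have G0 := euler_integral_real_gt0 be0.
move: (Re (euler_integral (Re be)%:C)) G0 iK => G G0 iK.
have h : mu.-integrable D0 (EFin \o (fun r => G^-1 * (G * b r))).
  apply: (integrableZl mD0 G^-1 (f := fun r => (G * b r)%:E)).
  apply/integrableP; split.
    by apply/measurable_EFinP; apply: measurable_funM.
  apply: le_lt_trans Afin; rewrite le_eqVlt; apply/orP; left; apply/eqP.
  apply: eq_integral => r; rewrite half_lineP => r0.
  by rewrite iK//= ger0_norm// mulr_ge0 ?normc_ge0// ltW.
apply: cintegrable_dominated (ccontinuous_measurable cb) _ h => r r0.
by rewrite mulKf// gt_eqF.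
Qed.

(** The double integral of the kernel is [Gamma al Gamma (be - al)] in one order
    and [Gamma be] times the beta integral in the other. *)
Lemma beta_integral al be : 0 < Re al -> Re al < Re be ->
  cintegrable D0 (fun r => cpow r (al - 1) * cpow (1 + r) (- be)) /\
  cintegral D0 (fun r => cpow r (al - 1) * cpow (1 + r) (- be)) =
    euler_integral al * euler_integral (be - al) / euler_integral be.
Proof.
move=> al0 albe; have be0 := lt_trans al0 albe.
have beal : 0 < Re (be - al) by rewrite ReB subr_gt0.
have be_neq0 := euler_integral_neq0 be0.
have [mR mI] := beta_kernel_measurable al be.
have Afin := beta_abs_integral al0 albe.
have normE (t r : R) :
    normc (beta_kernel al be t r) = normc (beta_kernel (Re al)%:C (Re be)%:C t r).
  by rewrite !normc_beta_kernel.
have fub : cintegral D0 (fun t => cintegral D0 (beta_kernel al be t)) =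
    cintegral D0 (fun r => cintegral D0 (beta_kernel al be ^~ r)).
  apply: (cintegral_fubini mR mI _ Afin).
  - by move=> t r _ _; rewrite normE.
  - by move=> t t0; have [] := beta_kernel_r be al0 t0.
  - by move=> r r0; have [] := beta_kernel_t al be0 r0.
have L : cintegral D0 (fun t => cintegral D0 (beta_kernel al be t)) =
    euler_integral al * euler_integral (be - al).
  have [_ <-] := cintegralZ (euler_integral al) (gamma_kernel_cintegrable beal).
  by apply: eq_cintegral => t t0; have [] := beta_kernel_r be al0 t0.
pose b r := cpow r (al - 1) * cpow (1 + r) (- be).
have ib : cintegrable D0 b := beta_integrable al0 albe.
split; first exact: ib.
have [_ e] := cintegralZ (euler_integral be) ib.
rewrite -L fub; have -> : cintegral D0 (fun r => cintegral D0 (beta_kernel al be ^~ r)) =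
    cintegral D0 (fun r => euler_integral be * b r).
  by apply: eq_cintegral => r r0; have [] := beta_kernel_t al be0 r0.
by rewrite e mulrC mulKf.
Qed.

End Beta.

(** * The integral of a single power *)

Section SinglePower.
Context {R : realType}.
Local Notation D0 := (`]0%R, +oo[%classic : set R).
Local Notation Re := (@complex.Re R).
Variable a : R.
Hypothesis a0 : 0 < a.

Let X (x : R) : R := x + a + Num.sqrt (x ^+ 2 + 2 * a * x).
Let phi (r : R) : R := a / 2 * (r ^+ 2 / (1 + r)).
Let dphi (r : R) : R := a / 2 * (r * (r + 2) / (1 + r) ^+ 2).

Let X_phi (r : R) : 0 < r -> X (phi r) = a * (1 + r).
Proof.
move=> r0; have r1 : 1 + r != 0 by rewrite gt_eqF// addr_gt0.
have -> : X (phi r) =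
    phi r + a + Num.sqrt ((a * (r * (r + 2) / (2 * (1 + r)))) ^+ 2).
  by rewrite /X; congr (_ + Num.sqrt _); rewrite /phi; field.
rewrite sqrtr_sqr ger0_norm; last first.
  by rewrite mulr_ge0 ?(ltW a0)// divr_ge0 ?mulr_ge0 ?addr_ge0 ?ltW.
by rewrite /phi; field.
Qed.

Lemma X_ge (x : R) : 0 < x -> a <= X x.
Proof. by move=> x0; rewrite /X addrAC lerDr addr_ge0 ?sqrtr_ge0// ltW. Qed.

Let phi_surj (y : R) : 0 < y -> exists2 x : R, 0 < x & phi x = y.
Proof.
move=> y0; have q0 : 0 < y ^+ 2 + 2 * a * y.
  by rewrite addr_gt0 ?exprn_gt0 ?mulr_gt0.
set q := Num.sqrt (y ^+ 2 + 2 * a * y).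
have q2 : q ^+ 2 = y ^+ 2 + 2 * a * y by rewrite sqr_sqrtr// ltW.
have qp : 0 < q by rewrite sqrtr_gt0.
(* The positive root of [a r^2 - 2 y r - 2 y = 0]. *)
exists ((y + q) / a); first by rewrite divr_gt0// addr_gt0.
have ayq : a + y + q != 0 by rewrite gt_eqF// !addr_gt0.
rewrite /phi; apply: (mulIf ayq).
have -> : a / 2 * (((y + q) / a) ^+ 2 / (1 + (y + q) / a)) * (a + y + q) =
    (y + q) ^+ 2 / 2.
  have an : a != 0 by rewrite gt_eqF.
  by field; rewrite an/= addrA.
by rewrite sqrrD q2; field.
Qed.

Let phi_gt0 (r : R) : 0 < r -> 0 < phi r.
Proof. by move=> r0; rewrite /phi mulr_gt0 ?divr_gt0 ?exprn_gt0 ?addr_gt0. Qed.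

Let dphi_gt0 (r : R) : 0 < r -> 0 < dphi r.
Proof. by move=> r0; rewrite /dphi mulr_gt0 ?divr_gt0 ?exprn_gt0 ?mulr_gt0 ?addr_gt0. Qed.

Let is_derive_phi (r : R) : 0 < r -> is_derive r 1 phi (dphi r).
Proof.
move=> r0; have r1 : 1 + r != 0 by rewrite gt_eqF// addr_gt0.
have d1 : is_derive r 1 (fun u : R => 1 + u) 1.
  have := is_deriveD (is_derive_cst (1 : R) r 1) (is_derive_id r 1).
  by rewrite add0r.
have d2 := @is_deriveV _ (fun u : R => 1 + u) r 1 1 r1 d1.
have di := is_derive_id r (1 : R).
have d3 := is_deriveM (is_deriveM di di) d2.
have -> : phi = (a / 2) *:
    ((id : R -> R) * (id : R -> R) * (fun u : R => (1 + u)^-1)).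
  by apply/funext => u; rewrite /phi expr2.
have d4 := @is_deriveZ _ _ _ _ (a / 2) r 1 _ d3.
apply: (is_derive_eq d4).
transitivity (a / 2 *
    ((r * r) * (- (1 + r) ^- 2 * 1) + (1 + r)^-1 * (r * 1 + r * 1))).
  by [].
by rewrite /dphi; field.
Qed.

Let continuous_dphi : continuous_pos dphi.
Proof.
have c1 (k x : R) : {for x, continuous (fun u : R => u + k)}.
  by apply: cvgD; [exact: cvg_id|exact: cst_continuous].
move=> x x0; apply: cvgM; first exact: cst_continuous.
have x1 : (1 + x) * (1 + x) != 0.
  by rewrite mulf_neq0// gt_eqF// addr_gt0.
have c2 : {for x, continuous (fun u : R => 1 + u)}.
  by apply: cvgD; [exact: cst_continuous|exact: cvg_id].
apply: cvgM; first by apply: cvgM; [exact: cvg_id|exact: c1].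
rewrite (_ : (fun u : R => (1 + u) ^- 2) = (fun u => ((1 + u) * (1 + u))^-1)).
  by rewrite expr2; apply: cvgV => //; apply: cvgM.
by apply/funext => u; rewrite expr2.
Qed.

Lemma continuous_X : continuous_pos X.
Proof.
move=> x x0.
have c : {for x, continuous (fun x : R => x ^+ 2 + 2 * a * x)}.
  rewrite (_ : (fun x : R => x ^+ 2 + 2 * a * x) = (fun x => x * x + 2 * a * x)).
    apply: cvgD; first by apply: cvgM; exact: cvg_id.
    by apply: cvgM; [exact: cst_continuous|exact: cvg_id].
  by apply/funext => u; rewrite expr2.
have cs : {for x, continuous (fun x : R => Num.sqrt (x ^+ 2 + 2 * a * x))}.
  by apply: (@continuous_comp _ _ _ _ Num.sqrt _ c); exact: sqrt_continuous.
apply: cvgD; last exact: cs.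
by apply: cvgD; [exact: cvg_id|exact: cst_continuous].
Qed.

Let single_kernel_continuous (m s : R[i]) :
  ccontinuous (fun x => cpow x (m - 1) * cpow (X x) (- s)).
Proof.
apply: ccontinuousM; first exact: ccontinuous_cpow_id.
apply: (@ccontinuous_cpow R X); first exact: continuous_X.
by move=> x x0; exact: lt_le_trans (X_ge x0).
Qed.

Let substituted (m s : R[i]) (r : R) : 0 < r ->
  (dphi r)%:C * (cpow (phi r) (m - 1) * cpow (X (phi r)) (- s)) =
  cpow (a / 2) m * cpow a (- s) *
    (cpow r (2 * m - 1) * cpow (1 + r) (- (s + m)) +
     cpow r (2 * m - 1) * cpow (1 + r) (- (s + m + 1))).
Proof.
move=> r0; have r1 : 0 < 1 + r by rewrite addr_gt0.
have a20 : 0 < a / 2 by rewrite divr_gt0.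
have -> : cpow (phi r) (m - 1) =
    cpow (a / 2) (m - 1) * (cpow r (2 * m - 2) * cpow (1 + r) (1 - m)).
  have rr : 0 < r * r by rewrite mulr_gt0.
  rewrite /phi expr2 cpowM ?divr_gt0//; congr (_ * _).
  rewrite cpowM ?invr_gt0// cpowM// cpowV// opprB -cpowD; congr (cpow _ _ * _); ring.
rewrite X_phi// [cpow (a * (1 + r)) _]cpowM//.
(* The split [r (r + 2) = r (1 + r) + r] of the numerator produces the two
   beta integrands. *)
have -> : (dphi r)%:C = cpow (a / 2) 1 *
    (cpow r 1 * (cpow (1 + r) (- 1) + cpow (1 + r) (- 2))).
  rewrite !cpow1// !cpowN cpow1// [cpow _ 2](cpow_nat 2 r1) /dphi.
  have r1C : (1 + r)%:C != 0 :> R[i] by rewrite (fmorph_eq0 (real_complex R)) gt_eqF.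
  rewrite -fmorphV -rmorphXn -fmorphV -rmorphD -!rmorphM; congr (_%:C).
  by rewrite /= ; field; rewrite gt_eqF.
have -> : cpow (a / 2) m = cpow (a / 2) 1 * cpow (a / 2) (m - 1).
  by rewrite -cpowD addrC subrK.
have -> : cpow r (2 * m - 1) = cpow r 1 * cpow r (2 * m - 2).
  by rewrite -cpowD; congr cpow; ring.
have -> : cpow (1 + r) (- (s + m)) =
    cpow (1 + r) (- 1) * cpow (1 + r) (1 - m) * cpow (1 + r) (- s).
  by rewrite -!cpowD; congr cpow; ring.
have -> : cpow (1 + r) (- (s + m + 1)) =
    cpow (1 + r) (- 2) * cpow (1 + r) (1 - m) * cpow (1 + r) (- s).
  by rewrite -!cpowD; congr cpow; ring.
ring.
Qed.

(** The substitution [x = a r^2 / (2 (1 + r))] rationalizes the square root,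
    since then [X = a (1 + r)], and yields two beta integrals. *)
Lemma single_power_integral (m s : R[i]) : 0 < Re m -> Re m < Re s ->
  cintegrable D0 (fun x => cpow x (m - 1) * cpow (X x) (- s)) /\
  cintegral D0 (fun x => cpow x (m - 1) * cpow (X x) (- s)) =
    s * cpow 2 (1 - m) * cpow a (m - s) *
    euler_integral (2 * m) * euler_integral (s - m) / euler_integral (1 + s + m).
Proof.
move=> m0 ms.
have Re2m : Re (2 * m) = 2 * Re m by rewrite natC ReZ.
have m20 : 0 < Re (2 * m) by rewrite Re2m mulr_gt0.
have sm0 : 0 < Re (s - m) by rewrite ReB subr_gt0.
have spm0 : 0 < Re (s + m) by rewrite ReD addr_gt0// (lt_trans m0).
have b1 : Re (2 * m) < Re (s + m) by rewrite Re2m ReD mulr2n mulrDl mul1r ltrD2r.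
have b2 : Re (2 * m) < Re (s + m + 1) by rewrite ReD (lt_trans b1)// ltrDl.
have [i1 e1] := beta_integral m20 b1.
have [i2 e2] := beta_integral m20 b2.
have [i3 e3] := cintegrableD i1 i2.
have [i4 e4] := cintegralZ (cpow (a / 2) m * cpow a (- s)) i3.
have ch := cintegral_change is_derive_phi continuous_dphi dphi_gt0 phi_gt0
  phi_surj (single_kernel_continuous m s).
have ich := cintegrable_change is_derive_phi continuous_dphi dphi_gt0 phi_gt0
  phi_surj (single_kernel_continuous m s).
split.
  apply: ich.2; apply: eq_cintegrable i4 => r r0; rewrite -substituted//.
rewrite ch (eq_cintegral (substituted m s)) e4 e3 e1 e2.
have -> : s + m - 2 * m = s - m by ring.
have -> : s + m + 1 - 2 * m = s - m + 1 by ring.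
have -> : 1 + s + m = s + m + 1 by ring.
rewrite !euler_integralS//.
have -> : cpow (a / 2) m = cpow a m * cpow 2 (- m).
  by rewrite cpowM ?invr_gt0// cpowV.
have -> : cpow 2 (1 - m) = 2 * cpow 2 (- m).
  by rewrite cpowD cpow1// natC.
have -> : cpow a (m - s) = cpow a m * cpow a (- s) by rewrite cpowD.
have n1 := euler_integral_neq0 spm0.
have n2 : s + m != 0 by apply/eqP => e; move: spm0; rewrite e ltxx.
by field; rewrite n1 n2.
Qed.

End SinglePower.

(** * Absolutely convergent multiple series *)

Section ComponentwiseLimits.
Context {R : realType}.
Local Notation Re := (@complex.Re R).
Local Notation Im := (@complex.Im R).
Implicit Types (u v : nat -> R[i]) (l m : R[i]).

(** Limits are taken componentwise, since the dominated convergence theorem and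
    the convergence criteria for series are applied to the real and imaginary
    parts. *)
Definition ccvg u l :=
  Re (u N) @[N --> \oo] --> Re l /\ Im (u N) @[N --> \oo] --> Im l.

Lemma ccvg_cst l : ccvg (fun=> l) l.
Proof. by split; exact: cvg_cst. Qed.

Lemma ccvgM u v l m : ccvg u l -> ccvg v m -> ccvg (fun N => u N * v N) (l * m).
Proof.
move=> [ur ui] [vr vi]; split.
  rewrite ReM (_ : (fun N => Re (u N * v N)) =
    (fun N => Re (u N) * Re (v N) - Im (u N) * Im (v N))).
    by apply: cvgB; apply: cvgM.
  by apply/funext => N; rewrite ReM.
rewrite ImM (_ : (fun N => Im (u N * v N)) =
  (fun N => Re (u N) * Im (v N) + Im (u N) * Re (v N))).
  by apply: cvgD; apply: cvgM.
by apply/funext => N; rewrite ImM.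
Qed.

Lemma ccvg_prod (I : Type) (r : seq I) (F : I -> nat -> R[i]) (l : I -> R[i]) :
  (forall i, ccvg (F i) (l i)) ->
  ccvg (fun N => \prod_(i <- r) F i N) (\prod_(i <- r) l i).
Proof.
move=> h; elim: r => [|i r IH].
  rewrite big_nil (_ : (fun N => _) = fun=> 1); first exact: ccvg_cst.
  by apply/funext => N; rewrite big_nil.
rewrite big_cons (_ : (fun N => _) = (fun N => F i N * \prod_(j <- r) F j N)).
  exact: ccvgM.
by apply/funext => N; rewrite big_cons.
Qed.

Lemma ccvg_dist u l (eps : R) : ccvg u l -> 0 < eps ->
  \forall N \near \oo, normc (l - u N) <= eps.
Proof.
move=> [ur ui] e0; have e20 : 0 < eps / 2 by rewrite divr_gt0.
move/cvgrPdist_le : ur => /(_ _ e20) ur; move/cvgrPdist_le : ui => /(_ _ e20) ui.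
near=> N; rewrite (le_trans (normc_le _))// ReB ImD ImN [leRHS]splitr lerD//.
  by near: N.
by near: N.
Unshelve. all: by end_near. Qed.

(** The norm of the complex numbers is itself complex-valued, but a tolerance is
    positive only if it is real. *)
Lemma cvg_normc (T : Type) (F : set_system T) {FF : Filter F} (f : T -> R[i]) l :
  (forall eps : R, 0 < eps -> \forall x \near F, normc (l - f x) <= eps) ->
  (f x : R[i]^o) @[x --> F] --> (l : R[i]^o).
Proof.
move=> h; apply/cvgrPdist_le => -[e e'] /=; rewrite ltcE/= => /andP[/eqP -> e0].
apply: filterS (h _ e0) => x hx.
by rewrite normc_norm lecR.
Qed.

Lemma bounded_series_cvg (t : nat -> R) (E : R) : (forall k, 0 <= t k) ->
  (forall N, \sum_(k < N) t k <= E) -> cvgn (fun N => \sum_(k < N) t k).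
Proof.
move=> t0 tE; apply: nondecreasing_is_cvgn.
  by apply/nondecreasing_seqP => N; rewrite big_ord_recr/= lerDl.
by exists E => _ [N _ <-].
Qed.

Lemma abs_series_cvg (t : nat -> R) (E : R) :
  (forall N, \sum_(k < N) `|t k| <= E) -> cvgn (fun N => \sum_(k < N) t k).
Proof.
move=> tE; have c := bounded_series_cvg (fun k => normr_ge0 (t k)) tE.
have -> : (fun N => \sum_(k < N) t k) = series t.
  by apply/funext => N; rewrite /series/= big_mkord.
apply: normed_cvg; rewrite (_ : [normed series t] = (fun N => \sum_(k < N) `|t k|))//.
by apply/funext => N; rewrite /normed_series_of seriesEord.
Qed.

(** The limit of a series is taken for the norm topology; absolute convergence
    gives the componentwise limit, and both agree. *)
Lemma cseries_cvg u (E : R) : (forall N, \sum_(k < N) normc (u k) <= E) ->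
  ccvg (fun N => \sum_(k < N) u k) (limn (series (u : nat -> R[i]^o))).
Proof.
move=> uE.
have cR : cvgn (fun N => \sum_(k < N) Re (u k)).
  apply: (@abs_series_cvg (fun k => Re (u k)) E) => N; apply: le_trans (uE N).
  by apply: ler_sum => k _; exact: Re_le_normc.
have cI : cvgn (fun N => \sum_(k < N) Im (u k)).
  apply: (@abs_series_cvg (fun k => Im (u k)) E) => N; apply: le_trans (uE N).
  by apply: ler_sum => k _; exact: Im_le_normc.
have c : ccvg (fun N => \sum_(k < N) u k)
    (limn (fun N => \sum_(k < N) Re (u k)) +i* limn (fun N => \sum_(k < N) Im (u k))).
  split.
    rewrite (_ : (fun N => Re _) = (fun N => \sum_(k < N) Re (u k)))//.
    by apply/funext => N; rewrite Re_sum.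
  rewrite (_ : (fun N => Im _) = (fun N => \sum_(k < N) Im (u k)))//.
  by apply/funext => N; rewrite Im_sum.
suff -> : limn (series (u : nat -> R[i]^o)) =
    limn (fun N => \sum_(k < N) Re (u k)) +i* limn (fun N => \sum_(k < N) Im (u k)) by [].
apply: cvg_lim; first exact: norm_hausdorff.
have -> : series (u : nat -> R[i]^o) = (fun N => \sum_(k < N) u k).
  by apply/funext => N; rewrite /series/= big_mkord.
by apply: cvg_normc => eps e0; exact: ccvg_dist.
Qed.

(** Once the ratio is at most one half, the partial sum plus twice the next
    term no longer increases. *)
Lemma ratio_bounded_series (e : nat -> R) (K : nat) : (forall k, 0 <= e k) ->
  (forall k, (K <= k)%N -> 2 * e k.+1 <= e k) ->
  exists E, forall N, \sum_(k < N) e k <= E.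
Proof.
move=> e0 eK; exists (\sum_(k < K) e k + 2 * e K) => N.
have [NK|/ltnW KN] := leqP N K.
  rewrite -(subnKC NK) big_split_ord/= -addrA lerDl addr_ge0 ?mulr_ge0//.
  by apply: sumr_ge0.
rewrite -(subnKC KN); move: (N - K)%N => m.
apply: (@le_trans _ _ (\sum_(k < K + m) e k + 2 * e (K + m)%N)).
  by rewrite lerDl mulr_ge0.
elim: m => [|m IH]; first by rewrite addn0.
apply: le_trans IH; rewrite addnS big_ord_recr/= -addrA lerD2l.
have := eK (K + m)%N (leq_addr _ _); lra.
Qed.

End ComponentwiseLimits.

Section MultipleSeries.
Context {R : realType} {n : nat}.
Local Notation index := {ffun 'I_n -> nat}.
Variable e : 'I_n -> nat -> R.
Hypothesis e0 : forall j k, 0 <= e j k.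
Variable E : 'I_n -> R.
Hypothesis eE : forall j N, \sum_(k < N) e j k <= E j.

Definition cube_index (N : nat) (f : {ffun 'I_n -> 'I_N}) : index :=
  [ffun j => f j : nat].

Definition cube (N : nat) : seq index := [seq cube_index f | f : {ffun 'I_n -> 'I_N}].

Let weight (k : index) : R := \prod_j e j (k j).

Let weight_ge0 k : 0 <= weight k. Proof. exact: prodr_ge0. Qed.

Lemma cube_uniq N : uniq (cube N).
Proof.
rewrite /cube /image_mem map_inj_uniq ?enum_uniq// => f g /ffunP fg.
by apply/ffunP => j; have := fg j; rewrite !ffunE => /val_inj.
Qed.

Lemma mem_cube N (k : index) : (k \in cube N) = [forall j, (k j < N)%N].
Proof.
rewrite /cube; apply/mapP/forallP => [[f _ ->] j|h]; first by rewrite ffunE.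
exists [ffun j => Ordinal (h j)]; first by rewrite mem_enum.
by apply/ffunP => j; rewrite !ffunE.
Qed.

Lemma sum_cube (V : nmodType) (F : index -> V) N :
  \sum_(k <- cube N) F k = \sum_(f : {ffun 'I_n -> 'I_N}) F (cube_index f).
Proof. by rewrite /cube /image_mem big_map big_enum. Qed.

(** A product of [n] partial sums is a sum over a cube: this makes cubes the
    finite sets of multi-indices along which the product of series is
    expanded. *)
Lemma prod_sum_cube (K : comPzRingType) (F : 'I_n -> nat -> K) N :
  \prod_j \sum_(k < N) F j k = \sum_(k <- cube N) \prod_j F j (k j).
Proof.
rewrite bigA_distr_bigA sum_cube; apply: eq_bigr => f _.
by apply: eq_bigr => j _; rewrite ffunE.
Qed.

Let cube_le N N' : (N <= N')%N -> {subset cube N <= cube N'}.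
Proof.
move=> NN' k; rewrite !mem_cube => /forallP h; apply/forallP => j.
exact: leq_trans (h j) NN'.
Qed.

Let sub_cube (s : seq index) : exists N, {subset s <= cube N}.
Proof.
elim: s => [|k s [N IH]]; first by exists 0%N.
exists (maxn N (\max_j (k j)).+1) => x; rewrite inE => /predU1P[->|/IH].
  rewrite mem_cube; apply/forallP => j.
  by rewrite leq_max ltnS (leq_bigmax j) orbT.
by apply: cube_le; rewrite leq_maxl.
Qed.

Let sum_sub (V : nmodType) (F : index -> V) (s t : seq index) :
  uniq s -> uniq t -> {subset s <= t} ->
  \sum_(k <- t) F k = \sum_(k <- s) F k + \sum_(k <- t | k \notin s) F k.
Proof.
move=> us ut st; rewrite (bigID (mem s))/=; congr (_ + _).
rewrite -big_filter; apply: perm_big; apply: uniq_perm => //.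
  exact: filter_uniq.
by move=> k; rewrite mem_filter; have [/st ->|] := boolP (k \in s).
Qed.

Let total N := \sum_(k <- cube N) weight k.

Let total_le N N' : (N <= N')%N -> total N <= total N'.
Proof.
move=> NN'; rewrite /total (sum_sub _ (cube_uniq N) (cube_uniq N') (cube_le NN')).
rewrite lerDl; apply: sumr_ge0 => k _; exact: weight_ge0.
Qed.

Let total_bounded N : total N <= \prod_j E j.
Proof.
rewrite /total -prod_sum_cube; apply: ler_prod => j _.
by rewrite eE andbT sumr_ge0.
Qed.

Let total_cvg : cvgn total.
Proof.
apply: nondecreasing_is_cvgn; first by move=> N N'; exact: total_le.
by exists (\prod_j E j) => _ [N _ <-]; exact: total_bounded.
Qed.

(** The total weight of the cubes is bounded by the product of the [E j], so
    that a finite set of multi-indices outside a large cube has small weight.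
    Hence the sums over the finite sets that contain this cube are close to the
    sum over it. *)
Lemma unconditional_sum_cvg (V : index -> R[i]) (M : R) (L : R[i]) :
  0 <= M -> (forall k, normc (V k) <= M * \prod_j e j (k j)) ->
  ccvg (fun N => \sum_(k <- cube N) V k) L ->
  (summability.partial_sum (V : index -> R[i]^o) B @[B --> summability.totally])
    --> (L : R[i]^o).
Proof.
have PF := @summability.totally_filter index.
move=> M0 VM VL; apply: cvg_normc => eps eps0.
have e20 : 0 < eps / 2 by rewrite divr_gt0.
have eM : 0 < eps / 2 / (M + 1) by rewrite divr_gt0// ltr_wpDl.
have /cvgrPdist_le/(_ _ eM) tN := total_cvg.
have [N [LN TN]] : exists N, normc (L - \sum_(k <- cube N) V k) <= eps / 2 /\
    `|limn total - total N| <= eps / 2 / (M + 1).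
  near \oo => N; exists N; split; near: N => //.
  exact: ccvg_dist.
exists [fset k in cube N]%fset => // B /= sB.
have cB : {subset cube N <= (enum_fset B : seq index)}.
  by move=> k kN; apply: (fsubsetP sB); rewrite inE.
rewrite /summability.partial_sum -(big_seq_fsetE _ _ xpredT).
have uB : uniq (enum_fset B) by exact: fset_uniq.
rewrite (sum_sub _ (cube_uniq N) uB cB) opprD addrA.
rewrite (le_trans (le_normcD _ _))// [leRHS]splitr lerD//.
rewrite normcN (le_trans (normc_sum _ _ _))//.
apply: (@le_trans _ _ (M * (limn total - total N))).
  apply: (@le_trans _ _ (M * \sum_(k <- enum_fset B | k \notin cube N) weight k)).
    by rewrite mulr_sumr; apply: ler_sum => k _; exact: VM.
  rewrite ler_wpM2l// lerBrDl -(sum_sub _ (cube_uniq N) uB cB).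
  have [N' BN'] := sub_cube (enum_fset B).
  apply: (@le_trans _ _ (total N')).
    rewrite /total (sum_sub _ uB (cube_uniq N') BN') lerDl.
    by apply: sumr_ge0 => k _; exact: weight_ge0.
  by apply: nondecreasing_cvgn_le => // N1 N2; exact: total_le.
have := le_trans (ler_norm _) TN; rewrite ler_pdivlMr ?ltr_wpDl// mulrC mulrDl mul1r.
apply: le_trans; rewrite lerDl subr_ge0.
by apply: nondecreasing_cvgn_le => // N1 N2; exact: total_le.
Unshelve. all: by end_near. Qed.

End MultipleSeries.

(** * The integral of a product of Struve functions *)

Section Pochhammer.
Context {R : realType}.
Implicit Types (z al : R[i]).

Lemma pochhammer_gamma al (k : nat) : ~ gamma_pole al ->
  pochhammer al k%:R = cgamma (al + k%:R) / cgamma al.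
Proof.
move=> np; rewrite /pochhammer; case: ifPn => [/andP[/asboolP//]|_].
by rewrite -natC.
Qed.

Lemma one_not_pole : ~ gamma_pole (1 : R[i]).
Proof. exact: pos_not_pole. Qed.

Lemma pochhammer1 (k : nat) : pochhammer (1 : R[i]) k%:R = k`!%:R.
Proof.
have np1 := one_not_pole.
rewrite pochhammer_gamma//; elim: k => [|k IH].
  by rewrite addr0 divff// cgamma_neq0.
rewrite -natr1 addrA cgammaS; last by apply: pos_not_pole; rewrite ReD Re_nat ltr_wpDr.
by rewrite -mulrA IH factS natrM nat1r.
Qed.

End Pochhammer.

Lemma struve_argument_power (F : numFieldType) (c Y a : F) (k : nat) : a != 0 ->
  (- c) ^+ k * (Y / 2) ^+ (2 * k) = (- (c * Y ^+ 2 / (4 * a ^+ 2))) ^+ k * a ^+ (2 * k).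
Proof.
move=> an; rewrite (exprM (Y / 2)) (exprM a) -[LHS]exprMn -[RHS]exprMn.
by congr (_ ^+ k); field.
Qed.

Section StruveSeries.
Context {R : realType}.
Local Notation Re := (@complex.Re R).
Variables (p b c : R[i]).
Hypothesis np : ~ gamma_pole (p + (b + 2) / 2).

Definition struve_term (x : R) (k : nat) : R[i] :=
  (- c) ^+ k * cpow (x / 2) (2 * k%:R + p + 1) /
    (cgamma (k%:R + 3 / 2) * cgamma (k%:R + p + (b + 2) / 2)).

Lemma struve_term_div (y X : R) (k : nat) : 0 < y -> 0 < X ->
  struve_term (y / X) k = struve_term y k * cpow X (- (2 * k%:R + p + 1)).
Proof.
move=> y0 X0; rewrite /struve_term.
have -> : y / X / 2 = y / 2 * X^-1 by rewrite mulrAC.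
rewrite cpowM ?divr_gt0 ?invr_gt0// cpowV//; ring.
Qed.

Lemma three_halves_pos : 0 < Re (3 / 2).
Proof.
have -> : (3 / 2 : R[i]) = (3 / 2 : R)%:C by rewrite rmorphM fmorphV/= -!natC.
by rewrite /= divr_gt0.
Qed.

(** By the recursion of the gamma function the ratio of consecutive terms is of
    order [1 / k^2]. *)
Lemma struve_term_ratio (y : R) (k : nat) : 0 < y ->
  struve_term y k.+1 = struve_term y k *
    (- c * cpow (y / 2) 2 / ((k%:R + 3 / 2) * (k%:R + (p + (b + 2) / 2)))).
Proof.
move=> y0; rewrite /struve_term.
have n1 : ~ gamma_pole (k%:R + 3 / 2 : R[i]).
  by apply: pos_not_pole; rewrite ReD Re_nat ltr_wpDl// three_halves_pos.
have n2 : ~ gamma_pole (k%:R + (p + (b + 2) / 2)).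
  by rewrite addrC; exact: not_pole_addn.
have -> : 2 * k.+1%:R + p + 1 = (2 * k%:R + p + 1) + 2 :> R[i].
  by rewrite -natr1; ring.
have -> : k.+1%:R + 3 / 2 = k%:R + 3 / 2 + 1 :> R[i] by rewrite -natr1; ring.
have -> : k.+1%:R + p + (b + 2) / 2 = k%:R + (p + (b + 2) / 2) + 1.
  by rewrite -natr1; ring.
have -> : k%:R + p + (b + 2) / 2 = k%:R + (p + (b + 2) / 2) by rewrite -addrA.
rewrite !cgammaS// cpowD exprSr.
move: (cgamma _) (cgamma _) (cpow _ _) (cpow _ _) ((- c) ^+ k) => g1 g2 u v w.
move: (k%:R + 3 / 2) (k%:R + (p + (b + 2) / 2)) => h1 h2.
rewrite !invfM; ring.
Qed.

Variables (a y : R).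
Hypotheses (a0 : 0 < a) (y0 : 0 < y).

(** The factor [a^(- 2 k)] bounds [X^(- 2 k)] on the range [a <= X], which makes
    the bound uniform in [X] up to the power [X^-(p + 1)]. *)
Definition struve_weight (k : nat) : R :=
  normc (struve_term y k) * expR (- (2 * k%:R * ln a)).

Lemma struve_weight_ge0 k : 0 <= struve_weight k.
Proof. by rewrite mulr_ge0 ?normc_ge0 ?expR_ge0. Qed.

Lemma struve_term_bound (X : R) (k : nat) : a <= X ->
  normc (struve_term (y / X) k) <= struve_weight k * normc (cpow X (- (p + 1))).
Proof.
move=> aX; have X0 : 0 < X by exact: lt_le_trans aX.
rewrite struve_term_div// ComplexField.Normc.normcM /struve_weight -[leRHS]mulrA.
rewrite ler_wpM2l ?normc_ge0// !normc_cpow -expRD ler_expR.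
have -> : Re (- (2 * k%:R + p + 1)) = - (2 * k%:R) + Re (- (p + 1)).
  rewrite !(ReN, ReD); have -> : Re (2 * k%:R) = 2 * k%:R by rewrite -natrM Re_nat natrM.
  ring.
rewrite mulrDl lerD2r mulNr lerN2 ler_wpM2l ?mulr_ge0//.
by rewrite ler_ln.
Qed.

Lemma struve_weight_bounded : exists E, forall N, \sum_(k < N) struve_weight k <= E.
Proof.
pose q := normc (- c * cpow (y / 2) 2) * expR (- (2 * ln a)).
have q0 : 0 <= q by rewrite mulr_ge0 ?normc_ge0 ?expR_ge0.
pose r := `|Re (p + (b + 2) / 2)|.
(* From this index on, the first factor of the denominator of the ratio is at
   least 1 and the second at least [2 q], so that the ratio is at most 1/2. *)
apply: (@ratio_bounded_series _ _ (Num.truncn (2 * q + r + 1)).+1).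
  exact: struve_weight_ge0.
move=> k Kk.
have kl : 2 * q + r + 1 <= k%:R.
  by rewrite (le_trans (ltW (truncnS_gt _)))// ler_nat.
have r0 : 0 <= r by exact: normr_ge0.
have h1 : 1 <= normc (k%:R + 3 / 2 : R[i]).
  apply: le_trans (Re_le_normc _); apply: le_trans (ler_norm _).
  rewrite ReD Re_nat (le_trans (y := k%:R))//; first by lra.
  by rewrite lerDl ltW// three_halves_pos.
have h2 : 2 * q + 1 <= normc (k%:R + (p + (b + 2) / 2)).
  apply: le_trans (Re_le_normc _); apply: le_trans (ler_norm _).
  rewrite ReD Re_nat; have := ler_norm (- Re (p + (b + 2) / 2)); rewrite normrN -/r; lra.
rewrite /struve_weight struve_term_ratio// ComplexField.Normc.normcM.
have -> : normc (- c * cpow (y / 2) 2 / ((k%:R + 3 / 2) * (k%:R + (p + (b + 2) / 2)))) =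
    normc (- c * cpow (y / 2) 2) /
      (normc (k%:R + 3 / 2 : R[i]) * normc (k%:R + (p + (b + 2) / 2))).
  by rewrite ComplexField.Normc.normcM ComplexField.Normc.normcV
    [normc ((_ + _) * _)]ComplexField.Normc.normcM.
have -> : expR (- (2 * k.+1%:R * ln a)) =
    expR (- (2 * k%:R * ln a)) * expR (- (2 * ln a)).
  by rewrite -expRD -natr1; congr expR; ring.
set N1 := normc (k%:R + 3 / 2 : R[i]) in h1 *.
set N2 := normc (k%:R + (p + (b + 2) / 2)) in h2 *.
set W := normc (struve_term y k); set T := expR (- (2 * k%:R * ln a)).
set B := normc (- c * cpow (y / 2) 2).
have N0 : 0 < N1 * N2 by rewrite mulr_gt0//; lra.
have -> : 2 * (W * (B / (N1 * N2)) * (T * expR (- (2 * ln a)))) =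
    W * T * (2 * q / (N1 * N2)) by rewrite /q -/B; ring.
rewrite ler_piMr ?mulr_ge0 ?normc_ge0 ?expR_ge0//.
rewrite ler_pdivrMr// mul1r (le_trans (y := N2))//; first by lra.
by rewrite ler_peMl//; lra.
Qed.

End StruveSeries.

Section NormIntegrable.
Context {R : realType}.
Local Notation mu := (@lebesgue_measure R).
Local Notation D0 := (`]0%R, +oo[%classic : set R).

Lemma cintegrable_normc (f : R -> R[i]) : cmeasurable f -> cintegrable D0 f ->
  mu.-integrable D0 (EFin \o (fun x => normc (f x))).
Proof.
move=> [mR mI] [iR iI].
have mD0 : measurable (D0 : set (measurableTypeR R)) by exact: measurable_itv.
have := integrableD mD0 (integrable_abse iR) (integrable_abse iI).
apply: le_integrable => //.
  by apply/measurable_EFinP; exact: measurable_normc.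
move=> x _; rewrite -[leRHS]/((`| `|complex.Re (f x)| + `|complex.Im (f x)| |)%:E).
rewrite lee_fin ger0_norm ?normc_ge0//.
by rewrite (le_trans (normc_le _))// ler_norm.
Qed.

End NormIntegrable.

Section StruveIntegral.
Context {R : realType} {n : nat}.
Local Notation mu := (@lebesgue_measure R).
Local Notation D0 := (`]0%R, +oo[%classic : set R).
Local Notation Re := (@complex.Re R).
Local Notation index := {ffun 'I_n -> nat}.
Variables (a : R) (y : 'I_n -> R) (b c lambda m : R[i]) (p : 'I_n -> R[i]).
Hypotheses (a0 : 0 < a) (y0 : forall j, 0 < y j).
Hypothesis np : forall j, ~ gamma_pole (p j + (b + 2) / 2).

Let P := \sum_(j < n) p j.
Let s := lambda + P + n%:R.
Let X (x : R) : R := x + a + Num.sqrt (x ^+ 2 + 2 * a * x).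

Hypotheses (m0 : 0 < Re m) (ms : Re m < Re s).

Let degree (k : index) : nat := \sum_j k j.

Let coefficient (k : index) : R[i] := \prod_j struve_term (p j) b c (y j) (k j).

(** Terms of the multiple series depend on [x] only through the total
    degree. *)
Let power_kernel (d : nat) (x : R) : R[i] :=
  cpow x (m - 1) * cpow (X x) (- (s + (2 * d)%:R)).

Let X_ge (x : R) : 0 < x -> a <= X x.
Proof. exact: X_ge. Qed.

Let shift_gt (d : nat) : Re m < Re (s + (2 * d)%:R).
Proof. by rewrite ReD Re_nat (lt_le_trans ms)// lerDl. Qed.

Let power_kernel_integral (d : nat) :
  cintegrable D0 (power_kernel d) /\
  cintegral D0 (power_kernel d) =
    (s + (2 * d)%:R) * cpow 2 (1 - m) * cpow a (m - (s + (2 * d)%:R)) *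
    euler_integral (2 * m) * euler_integral (s + (2 * d)%:R - m) /
    euler_integral (1 + (s + (2 * d)%:R) + m).
Proof. exact: (single_power_integral a0 m0 (shift_gt d)). Qed.

Let struve_prod_term (x : R) (k : index) : 0 < x ->
  cpow x (m - 1) * cpow (X x) (- lambda) *
    \prod_j struve_term (p j) b c (y j / X x) (k j) =
  coefficient k * power_kernel (degree k) x.
Proof.
move=> x0; have X0 : 0 < X x by exact: lt_le_trans (X_ge x0).
rewrite (eq_bigr (fun j => struve_term (p j) b c (y j) (k j) *
  cpow (X x) (- (2 * (k j)%:R + p j + 1)))); last first.
  by move=> j _; rewrite struve_term_div.
rewrite big_split/= -cpow_sum /power_kernel.
have -> : - (s + (2 * degree k)%:R) =
    - lambda + \sum_j (- (2 * (k j)%:R + p j + 1)).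
  rewrite sumrN !big_split/= -mulr_sumr sumr_const card_ord -/P.
  by rewrite /degree natrM natr_sum /s; ring.
by rewrite [cpow (X x) (- lambda + _)]cpowD /coefficient; ring.
Qed.

Let partial_integrand (N : nat) (x : R) : R[i] :=
  cpow x (m - 1) * cpow (X x) (- lambda) *
  \prod_j \sum_(k < N) struve_term (p j) b c (y j / X x) k.

Let partial_integrandE N x : 0 < x -> partial_integrand N x =
  \sum_(k <- cube N) coefficient k * power_kernel (degree k) x.
Proof.
move=> x0; rewrite /partial_integrand.
rewrite (prod_sum_cube (fun j k => struve_term (p j) b c (y j / X x) k)).
by rewrite mulr_sumr; apply: eq_bigr => k _; rewrite struve_prod_term.
Qed.

Let partial_integral N :
  cintegrable D0 (partial_integrand N) /\
  cintegral D0 (partial_integrand N) =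
  \sum_(k <- cube N) coefficient k * cintegral D0 (power_kernel (degree k)).
Proof.
have ik (k : index) :
    cintegrable D0 (fun x => coefficient k * power_kernel (degree k) x) /\
    cintegral D0 (fun x => coefficient k * power_kernel (degree k) x) =
    coefficient k * cintegral D0 (power_kernel (degree k)).
  exact: cintegralZ (power_kernel_integral _).1.
have [i e] := cintegral_sum (cube N) (fun k => (ik k).1).
split.
  by apply: eq_cintegrable i => x x0; rewrite partial_integrandE.
rewrite (eq_cintegral (partial_integrandE N)) e.
by apply: eq_bigr => k _; rewrite (ik k).2.
Qed.

Let integrand (x : R) : R[i] :=
  cpow x (m - 1) * cpow (X x) (- lambda) *
  \prod_j struve (p j) b c (y j / X x).

Let weight j := struve_weight (p j) b c a (y j).

Let weight_bounds : exists E : 'I_n -> R, forall j N, \sum_(k < N) weight j k <= E j.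
Proof.
apply: (@fin_all_exists _ _ (fun j E => forall N, \sum_(k < N) weight j k <= E)) => j.
exact: struve_weight_bounded.
Qed.

Let terms_bound (E : 'I_n -> R) j N x : (forall N, \sum_(k < N) weight j k <= E j) ->
  0 < x ->
  \sum_(k < N) normc (struve_term (p j) b c (y j / X x) k) <=
    E j * normc (cpow (X x) (- (p j + 1))).
Proof.
move=> hE x0; apply: (@le_trans _ _ (\sum_(k < N)
    weight j k * normc (cpow (X x) (- (p j + 1))))).
  by apply: ler_sum => k _; apply: struve_term_bound => //; exact: X_ge.
by rewrite -mulr_suml ler_wpM2r ?normc_ge0.
Qed.

(** The powers [X^-(p j + 1)] of the separate bounds combine with
    [X^(- lambda)] into [X^(- s)]. *)
Let partial_integrand_bound (E : 'I_n -> R) N x :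
  (forall j N, \sum_(k < N) weight j k <= E j) -> 0 < x ->
  normc (partial_integrand N x) <= (\prod_j E j) * normc (power_kernel 0 x).
Proof.
move=> hE x0; rewrite /partial_integrand ComplexField.Normc.normcM normc_prod.
have -> : (\prod_j E j) * normc (power_kernel 0 x) =
    normc (cpow x (m - 1) * cpow (X x) (- lambda)) *
    \prod_j (E j * normc (cpow (X x) (- (p j + 1)))).
  have -> : \prod_j (E j * normc (cpow (X x) (- (p j + 1)))) =
      (\prod_j E j) * normc (cpow (X x) (\sum_j - (p j + 1))).
    by rewrite cpow_sum normc_prod -big_split.
  rewrite [RHS]mulrCA; congr (_ * _).
  rewrite -ComplexField.Normc.normcM -mulrA -cpowD /power_kernel.
  congr (normc (_ * cpow _ _)).
  rewrite muln0 addr0 sumrN big_split/= sumr_const card_ord -/P /s; ring.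
rewrite ler_wpM2l ?normc_ge0//; apply: ler_prod => j _.
by rewrite normc_ge0/= (le_trans (normc_sum _ _ _))// terms_bound.
Qed.

Let X_continuous : continuous_pos X.
Proof. exact: (@continuous_X _ a). Qed.

Let power_kernel_continuous d : ccontinuous (power_kernel d).
Proof.
apply: ccontinuousM; first exact: ccontinuous_cpow_id.
by apply: (ccontinuous_cpow _ X_continuous) => x x0; exact: lt_le_trans (X_ge x0).
Qed.

Let partial_integrand_continuous N : ccontinuous (partial_integrand N).
Proof.
apply: (@eq_ccontinuous _ (fun x =>
    \sum_(k <- cube N) coefficient k * power_kernel (degree k) x)).
  by move=> x x0; rewrite partial_integrandE.
apply: ccontinuous_sum => k; apply: ccontinuousM; first exact: ccontinuous_cst.
exact: power_kernel_continuous.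
Qed.

Let majorant_integrable : mu.-integrable D0 (EFin \o (fun x => normc (power_kernel 0 x))).
Proof.
apply: cintegrable_normc; last exact: (power_kernel_integral 0).1.
exact: (ccontinuous_measurable (power_kernel_continuous 0)).
Qed.

Let partial_integrand_cvg x : 0 < x ->
  ccvg (fun N => partial_integrand N x) (integrand x).
Proof.
move=> x0; have [E hE] := weight_bounds.
apply: ccvgM; first exact: ccvg_cst.
apply: ccvg_prod => j; apply: cseries_cvg => N; exact: terms_bound (hE j) x0.
Qed.

(** The products of partial sums converge to the integrand and are dominated by
    a multiple of the kernel of degree 0. *)
Lemma struve_integral_cvg :
  cintegrable D0 integrand /\
  ccvg (fun N => \sum_(k <- cube N)
      coefficient k * cintegral D0 (power_kernel (degree k)))
    (cintegral D0 integrand).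
Proof.
have [E hE] := weight_bounds.
have mD0 : measurable (D0 : set (measurableTypeR R)) by exact: measurable_itv.
have [|i cR cI] := cintegral_dominated_cvg
  (fun N => ccontinuous_measurable (partial_integrand_continuous N))
  (fun x x0 => (partial_integrand_cvg x0).1) (fun x x0 => (partial_integrand_cvg x0).2)
  (fun N x => partial_integrand_bound N hE).
  exact: (integrableZl mD0 (\prod_j E j)
    (f := fun x => (normc (power_kernel 0 x))%:E) majorant_integrable).
split=> //; rewrite /ccvg; under eq_fun do rewrite -(partial_integral _).2.
split=> //; by under eq_fun do rewrite -(partial_integral _).2.
Qed.

(** As [a <= X], the integral of the kernel of degree [d] is at most of order
    [a^(- 2 d)], which is the factor contained in the weights. *)
Lemma struve_integral_term_bound : exists2 M : R, 0 <= M &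
  forall k, normc (coefficient k * cintegral D0 (power_kernel (degree k))) <=
    M * \prod_j weight j (k j).
Proof.
have mD0 : measurable (D0 : set (measurableTypeR R)) by exact: measurable_itv.
exists (2 * \int[mu]_(x in D0) normc (power_kernel 0 x)).
  by rewrite mulr_ge0//; apply: Rintegral_ge0 => x _; exact: normc_ge0.
move=> k; set d := degree k.
have wE : \prod_j weight j (k j) =
    normc (coefficient k) * expR (- ((2 * d)%:R * ln a)).
  rewrite /weight /struve_weight big_split/= -normc_prod; congr (_ * _).
  rewrite -expR_sum; congr expR.
  by rewrite sumrN -mulr_suml -mulr_sumr -natr_sum -natrM.
rewrite wE ComplexField.Normc.normcM mulrCA ler_wpM2l ?normc_ge0//.
have bound x : 0 < x -> normc (power_kernel d x) <=
    expR (- ((2 * d)%:R * ln a)) * normc (power_kernel 0 x).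
  move=> x0; have X0 : 0 < X x by exact: lt_le_trans (X_ge x0).
  have -> : power_kernel d x = cpow (X x) (- (2 * d)%:R) * power_kernel 0 x.
    rewrite /power_kernel muln0 addr0 opprD [cpow (X x) (_ - _)]cpowD; ring.
  rewrite ComplexField.Normc.normcM ler_wpM2r ?normc_ge0// normc_cpow ler_expR.
  by rewrite ReN Re_nat mulNr lerN2 ler_wpM2l// ler_ln// X_ge.
have ib := integrableZl mD0 (expR (- ((2 * d)%:R * ln a)))
  (f := fun x => (normc (power_kernel 0 x))%:E) majorant_integrable.
have := normc_cintegral (ccontinuous_measurable (power_kernel_continuous d)) bound ib.
by rewrite RintegralZl// (mulrC (expR _)) mulrA.
Qed.

Definition struve_prefactor : R[i] :=
  ((lambda + P + n%:R) * cpow 2 (1 - m - P - n%:R) *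
   cpow a (m - lambda - P - n%:R) *
   cgamma (2 * m) * cgamma (lambda + P + n%:R - m) *
   \prod_(j < n) cpow (y j) (p j + 1)) /
  (cgamma (3 / 2) ^+ n * cgamma (1 + lambda + P + n%:R + m) *
   \prod_(j < n) cgamma (p j + (b + 2) / 2)).

Let s_pos : 0 < Re s. Proof. exact: lt_trans ms. Qed.

Lemma struve_prefactor_neq0 : struve_prefactor != 0.
Proof.
have g1 : cgamma (2 * m) != 0.
  by apply/cgamma_neq0/pos_not_pole; rewrite natC ReZ mulr_gt0.
have g2 : cgamma (s - m) != 0.
  by apply/cgamma_neq0/pos_not_pole; rewrite ReB subr_gt0.
have g3 : cgamma (1 + s + m) != 0.
  by apply/cgamma_neq0/pos_not_pole; rewrite ReD [Re (1 + _)]ReD Re1 !addr_gt0.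
have g4 : cgamma (3 / 2 : R[i]) != 0.
  exact/cgamma_neq0/pos_not_pole/three_halves_pos.
have s_neq0 : s != 0 by apply/eqP => e; move: s_pos; rewrite e ltxx.
rewrite /struve_prefactor -/s mulf_neq0 ?invr_eq0//.
  apply: mulf_neq0; last by apply/prodf_neq0 => j _; exact: cpow_neq0.
  apply: mulf_neq0; last exact: g2.
  apply: mulf_neq0; last exact: g1.
  apply: mulf_neq0; last exact: cpow_neq0.
  by apply: mulf_neq0; last exact: cpow_neq0.
have -> : 1 + lambda + P + n%:R + m = 1 + s + m by rewrite /s; ring.
apply: mulf_neq0; last by apply/prodf_neq0 => j _; exact/cgamma_neq0/np.
by apply: mulf_neq0; [rewrite expf_neq0|exact: g3].
Qed.

Let twos : 'I_n -> R := fun=> 2.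
Let num := [:: (1 + lambda + P + n%:R, twos); (lambda + P + n%:R - m, twos)].
Let num1 := fun _ : 'I_n => [:: (1 : R[i], 1 : R)].
Let den := [:: (lambda + P + n%:R, twos); (1 + lambda + P + n%:R + m, twos)].
Let den1 := fun j : 'I_n =>
  [:: (3 / 2 : R[i], 1 : R); (p j + (b + 2) / 2, 1 : R)].
Let z := fun j : 'I_n => - (c * (y j)%:C ^+ 2 / (4 * a%:C ^+ 2)).

Let joint_exponent (k : index) : \sum_j (k j)%:R * twos j = (2 * degree k)%:R :> R.
Proof. by rewrite -mulr_suml -natr_sum mulrC -natrM. Qed.

Let struve_factor j k :
  struve_term (p j) b c (y j) k =
  (cpow 2 (- (p j + 1)) * cpow (y j) (p j + 1) * a%:C ^+ (2 * k)) /
  (cgamma (3 / 2) * cgamma (p j + (b + 2) / 2)) *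
  (pochhammer (1 : R[i]) k%:R /
    (pochhammer (3 / 2 : R[i]) k%:R * pochhammer (p j + (b + 2) / 2) k%:R) *
   (z j ^+ k / k`!%:R)).
Proof.
rewrite pochhammer1 !pochhammer_gamma//; last exact/pos_not_pole/three_halves_pos.
have g4 : cgamma (3 / 2 : R[i]) != 0.
  exact/cgamma_neq0/pos_not_pole/three_halves_pos.
have gb := cgamma_neq0 (@np j).
have g5 : cgamma (3 / 2 + k%:R : R[i]) != 0.
  exact/cgamma_neq0/not_pole_addn/pos_not_pole/three_halves_pos.
have g6 := cgamma_neq0 (not_pole_addn (k := k) (@np j)).
have f0 : (k`!%:R : R[i]) != 0 by rewrite pnatr_eq0 -lt0n fact_gt0.
have aC : a%:C != 0 :> R[i] by rewrite (fmorph_eq0 (real_complex R)) gt_eqF.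
rewrite /struve_term.
have -> : k%:R + 3 / 2 = 3 / 2 + k%:R :> R[i] by rewrite addrC.
have -> : k%:R + p j + (b + 2) / 2 = p j + (b + 2) / 2 + k%:R.
  by rewrite -addrA addrC.
have -> : cpow (y j / 2) (2 * k%:R + p j + 1) =
    ((y j)%:C / 2) ^+ (2 * k) * (cpow (y j) (p j + 1) * cpow 2 (- (p j + 1))).
  have -> : 2 * k%:R = (2 * k)%:R :> R[i] by rewrite natrM.
  rewrite -[X in cpow _ X = _]addrA (cpowD _ (2 * k)%:R) (cpow_nat (2 * k)) ?divr_gt0//.
  rewrite cpowM ?invr_gt0// cpowV//; congr (_ ^+ _ * _).
  by rewrite rmorphM fmorphV/= -natC.
have -> : (- c) ^+ k * (((y j)%:C / 2) ^+ (2 * k) *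
    (cpow (y j) (p j + 1) * cpow 2 (- (p j + 1)))) =
    z j ^+ k * a%:C ^+ (2 * k) * (cpow (y j) (p j + 1) * cpow 2 (- (p j + 1))).
  by rewrite [LHS]mulrA; congr (_ * _); exact: struve_argument_power.
move: (cgamma (3 / 2 + _)) (cgamma (p j + (b + 2) / 2 + _)) g5 g6 => G1 G2 g5 g6.
move: (cgamma (3 / 2)) (cgamma (p j + (b + 2) / 2)) g4 gb => G3 G4 g4 gb.
move: (k`!%:R : R[i]) (z j ^+ k) (a%:C ^+ (2 * k)) (cpow (y j) _) (cpow 2 _) f0.
move=> F Z Ak Y T f0.
by field; rewrite f0 g6 g5 gb g4.
Qed.

(** The part of a term that does not involve the integral over [x]: it carries
    the single-variable symbols and the arguments [z j], up to a power
    [a^(2 |k|)] that the integral cancels. *)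
Let coefficientE (k : index) : coefficient k =
  cpow 2 (- (P + n%:R)) * (\prod_j cpow (y j) (p j + 1)) * a%:C ^+ (2 * degree k) /
  (cgamma (3 / 2) ^+ n * \prod_j cgamma (p j + (b + 2) / 2)) *
  (single_poch num1 k / single_poch den1 k * \prod_j (z j ^+ k j / (k j)`!%:R)).
Proof.
have n1 : single_poch num1 k = \prod_j pochhammer (1 : R[i]) (k j)%:R.
  by apply: eq_bigr => j _; rewrite /num1 big_seq1/= mulr1.
have d1 : single_poch den1 k =
    \prod_j (pochhammer (3 / 2 : R[i]) (k j)%:R *
      pochhammer (p j + (b + 2) / 2) (k j)%:R).
  by apply: eq_bigr => j _; rewrite /den1 big_cons big_seq1/= mulr1.
have e1 : cpow 2 (- (P + n%:R)) = \prod_j cpow 2 (- (p j + 1)) :> R[i].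
  rewrite -cpow_sum; congr cpow.
  by rewrite sumrN big_split/= sumr_const card_ord.
have e2 : a%:C ^+ (2 * degree k) = \prod_j a%:C ^+ (2 * k j) :> R[i].
  by rewrite prodrXr -big_distrr.
have e3 : cgamma (3 / 2) ^+ n = \prod_(j < n) cgamma (3 / 2) :> R[i].
  by rewrite prodr_const card_ord.
rewrite n1 d1 e1 e2 e3 -!big_split/= -!prodf_div -!big_split/=.
by apply: eq_bigr => j _; exact: struve_factor.
Qed.

(** The recursion of the gamma function accounts for the factor
    [s + 2 degree k] of the single integral, through the quotient of the
    symbols of [1 + s] and of [s]. *)
Let term_value (k : index) :
  coefficient k * cintegral D0 (power_kernel (degree k)) =
  struve_prefactor * lauricella_term num num1 den den1 z k.
Proof.
have sp := s_pos.
have np1 : ~ gamma_pole s by exact: pos_not_pole.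
have np2 : ~ gamma_pole (1 + s).
  by apply: pos_not_pole; rewrite ReD Re1 addr_gt0.
have np3 : ~ gamma_pole (s - m) by apply: pos_not_pole; rewrite ReB subr_gt0.
have np4 : ~ gamma_pole (1 + s + m).
  by apply: pos_not_pole; rewrite ReD [Re (1 + _)]ReD Re1 !addr_gt0.
set d := degree k.
have np5 : ~ gamma_pole (s + (2 * d)%:R).
  by apply: pos_not_pole; rewrite ReD Re_nat ltr_wpDr.
have numE : joint_poch num k =
    cgamma (1 + s + (2 * d)%:R) / cgamma (1 + s) *
    (cgamma (s - m + (2 * d)%:R) / cgamma (s - m)).
  rewrite /joint_poch /num big_cons big_seq1/= joint_exponent.
  have -> : 1 + lambda + P + n%:R = 1 + s by rewrite /s; ring.
  by rewrite !pochhammer_gamma.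
have denE : joint_poch den k =
    cgamma (s + (2 * d)%:R) / cgamma s *
    (cgamma (1 + s + m + (2 * d)%:R) / cgamma (1 + s + m)).
  rewrite /joint_poch /den big_cons big_seq1/= joint_exponent.
  have -> : 1 + lambda + P + n%:R + m = 1 + s + m by rewrite /s; ring.
  by rewrite !pochhammer_gamma.
have [_ ->] := power_kernel_integral d.
rewrite -!cgammaE; last 3 first.
- by rewrite ReD [Re (1 + _)]ReD Re1 !addr_gt0// ReD Re_nat ltr_wpDr.
- by rewrite ReB subr_gt0.
- by rewrite natC ReZ mulr_gt0.
rewrite coefficientE -/d /lauricella_term numE denE /struve_prefactor.
have -> : 1 + lambda + P + n%:R + m = 1 + s + m by rewrite /s; ring.
have -> : lambda + P + n%:R - m = s - m by [].
have -> : lambda + P + n%:R = s by [].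
have -> : m - lambda - P - n%:R = m - s by rewrite /s; ring.
have -> : 1 - m - P - n%:R = 1 - m - (P + n%:R) by ring.
have -> : 1 + s + (2 * d)%:R = s + (2 * d)%:R + 1 by ring.
have -> : 1 + (s + (2 * d)%:R) + m = 1 + s + m + (2 * d)%:R by ring.
have -> : s + (2 * d)%:R - m = s - m + (2 * d)%:R by ring.
have -> : 1 + s = s + 1 by ring.
have -> : cpow 2 (1 - m - (P + n%:R)) = cpow 2 (1 - m) * cpow 2 (- (P + n%:R)) :> R[i].
  by rewrite -cpowD.
have -> : cpow a (m - (s + (2 * d)%:R)) = cpow a (m - s) / a%:C ^+ (2 * d).
  by rewrite -cpow_nat// -cpowB; congr cpow; ring.
rewrite !cgammaS//.
have h1 : s != 0 by have := not_pole_neq0 0 np1; rewrite addr0.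
have h2 := cgamma_neq0 np1.
have h3 := cgamma_neq0 np3.
have h4 := cgamma_neq0 np5.
have h5 : cgamma (s + 1 + m) != 0.
  by apply/cgamma_neq0/pos_not_pole; rewrite ReD [Re (s + _)]ReD Re1 !addr_gt0.
have h6 : a%:C ^+ (2 * d) != 0 :> R[i].
  by rewrite expf_neq0// (fmorph_eq0 (real_complex R)) gt_eqF.
have h7 : cgamma (s + 1 + m + (2 * d)%:R) != 0.
  apply/cgamma_neq0/not_pole_addn/pos_not_pole.
  by rewrite ReD [Re (s + _)]ReD Re1 !addr_gt0.
have h8 : cgamma (3 / 2 : R[i]) ^+ n != 0.
  by rewrite expf_neq0//; exact/cgamma_neq0/pos_not_pole/three_halves_pos.
have h9 : \prod_j cgamma (p j + (b + 2) / 2) != 0.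
  by apply/prodf_neq0 => j _; exact/cgamma_neq0/np.
have split_quotient (N D S1 S2 : R[i]) : N * S1 / (D * S2) = N / D * (S1 / S2).
  by rewrite invfM; ring.
rewrite (split_quotient _ _ (single_poch num1 k)).
move: (cgamma (s + 1 + m + _)) (cgamma (s - m + _)) h7 => G1 G2 h7.
move: (cgamma (s + 1 + m)) (cgamma (s + (2 * d)%:R)) (cgamma s) (cgamma (s - m))
  h2 h3 h4 h5.
move=> G3 G4 G5 G6 h2 h3 h4 h5.
move: (a%:C ^+ (2 * d)) h6 => A h6.
move: (cgamma (2 * m)) (cpow a _) (cpow 2 (1 - m)) (cpow 2 (- _)) => G7 A1 T1 T2.
move: (\prod_j cpow _ _) (\prod_j (z j ^+ _ / _)).
move: (single_poch num1 k / single_poch den1 k).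
move: (cgamma (3 / 2) ^+ n) (\prod_j cgamma _) h8 h9 => B1 B2 h8 h9 S Y Z.
move: s (2 * d)%:R h1 => t D h1.
by field; rewrite ?h1 ?h2 ?h3 ?h4 ?h5 ?h6 ?h7 ?h8 ?h9.
Qed.

(** Since the prefactor does not vanish, the multiple series of integrals can be
    divided by it, which gives both the convergence and the value of the
    Lauricella series. *)
Lemma struve_integral_lauricella :
  [/\ cintegrable D0 integrand,
      lauricella_cvg num num1 den den1 z &
      cintegral D0 integrand = struve_prefactor * lauricella num num1 den den1 z].
Proof.
have [i L] := struve_integral_cvg.
have [M M0 hM] := struve_integral_term_bound.
have [E hE] := weight_bounds.
have A0 := struve_prefactor_neq0.
pose l := struve_prefactor^-1 * cintegral D0 integrand.
have termE k : lauricella_term num num1 den den1 z k =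
    struve_prefactor^-1 * (coefficient k * cintegral D0 (power_kernel (degree k))).
  by rewrite term_value mulKf.
have cv : (summability.partial_sum (lauricella_term num num1 den den1 z) B
    @[B --> summability.totally]) --> (l : R[i]^o).
  apply: (unconditional_sum_cvg (e := weight) (E := E) _ hE
    (M := normc struve_prefactor^-1 * M)).
  - by move=> j k; exact: struve_weight_ge0.
  - by rewrite mulr_ge0// normc_ge0.
  - move=> k; rewrite termE ComplexField.Normc.normcM -mulrA.
    by rewrite ler_wpM2l ?normc_ge0// hM.
  - have := ccvgM (ccvg_cst struve_prefactor^-1) L; congr (ccvg _ _).
    apply/funext => N; rewrite mulr_sumr; apply: eq_bigr => k _.
    by rewrite termE.
split; [exact: i|by apply/cvg_ex; exists l|].
rewrite /lauricella /summability.sum.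
have PF := @summability.totally_filter index.
rewrite (cvg_lim _ cv); last exact: norm_hausdorff.
by rewrite /l mulVKf.
Qed.

End StruveIntegral.

Theorem theorem1 (R : realType) (n : nat) (a : R) (y : 'I_n -> R)
    (b c lambda mu : R[i]) (p : 'I_n -> R[i])
    (n_gt0 : (0 < n)%N) (a_gt0 : 0 < a) (y_gt0 : forall j, 0 < y j)
    (not_pole : forall j, ~ gamma_pole (p j + (b + 2) / 2)) :
  let P := \sum_(j < n) p j in
  let X (x : R) : R := x + a + Num.sqrt (x ^+ 2 + 2 * a * x) in
  let integrand (x : R) : R[i] :=
    cpow x (mu - 1) * cpow (X x) (- lambda) *
    \prod_(j < n) struve (p j) b c (y j / X x) in
  let A : R[i] :=
    ((lambda + P + n%:R) * cpow 2 (1 - mu - P - n%:R) *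
     cpow a (mu - lambda - P - n%:R) *
     cgamma (2 * mu) * cgamma (lambda + P + n%:R - mu) *
     \prod_(j < n) cpow (y j) (p j + 1)) /
    (cgamma (3 / 2) ^+ n * cgamma (1 + lambda + P + n%:R + mu) *
     \prod_(j < n) cgamma (p j + (b + 2) / 2)) in
  let twos : 'I_n -> R := fun=> 2 in
  let num := [:: (1 + lambda + P + n%:R, twos);
                 (lambda + P + n%:R - mu, twos)] in
  let num1 := fun _ : 'I_n => [:: (1 : R[i], 1 : R)] in
  let den := [:: (lambda + P + n%:R, twos);
                 (1 + lambda + P + n%:R + mu, twos)] in
  let den1 := fun j : 'I_n =>
    [:: (3 / 2 : R[i], 1 : R); (p j + (b + 2) / 2, 1 : R)] in
  let z := fun j : 'I_n =>
    - (c * (y j)%:C ^+ 2 / (4 * a%:C ^+ 2)) in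
  0 < complex.Re mu -> complex.Re mu < complex.Re (lambda + P) + n%:R ->
  [/\ cintegrable `]0, +oo[ integrand,
      lauricella_cvg num num1 den den1 z &
      cintegral `]0, +oo[ integrand = A * lauricella num num1 den den1 z].
Proof.
move=> P X integrand A twos num num1 den den1 z mu_gt0 mu_lt.
apply: struve_integral_lauricella => //.
by rewrite ReD Re_nat.
Qed.
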